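(* For any composition $\boldsymbol{k}=(k_1,\ldots,k_r)$ and any $\alpha\in\mathbb{C}\setminus\mathbb{N}$, the following formula holds: $$\int_0^1\frac{\mathrm{Li}_{\boldsymbol{k}}\big(\frac{x}{x-1}\big)}{x(1-x)^\alpha}\,dx=(-1)^r\,\zeta^\star\big((\overleftarrow{\boldsymbol{k}}^\vee)_+;1-\alpha\big).$$
   Context: $\mathbb{N}$ is the set of positive integers. A composition is a finite sequence $\boldsymbol{k}=(k_1,\ldots,k_r)\in\mathbb{N}^r$, $r\ge 1$; its weight is $|\boldsymbol{k}|=k_1+\cdots+k_r$. The reversal is $\overleftarrow{\boldsymbol{k}}=(k_r,\ldots,k_1)$, and $\boldsymbol{k}_+=(k_1+1,k_2,\ldots,k_r)$. The Hoffman dual $\boldsymbol{k}^\vee=(k'_1,\ldots,k'_{r'})$ of $\boldsymbol{k}$ is the unique composition of the same weight such that $\{1,2,\ldots,|\boldsymbol{k}|-1\}$ is the disjoint union of $\{\sum_{i=1}^{j}k_i: 1\le j\le r-1\}$ and $\{\sum_{i=1}^{j}k'_i:1\le j\le r'-1\}$. The notation $\overleftarrow{\boldsymbol{k}}^\vee$ means $(\overleftarrow{\boldsymbol{k}})^\vee$. The multiple polylogarithm is $\mathrm{Li}_{\boldsymbol{k}}(z)=\sum_{n_1>\cdots>n_r>0}\frac{z^{n_1}}{n_1^{k_1}\cdots n_r^{k_r}}$ for $z\in[-1,1)$, and for all real $z<1$ it is given by the iterated integral $$\mathrm{Li}_{\boldsymbol{k}}(z)=\int_0^z\Big(\frac{dt}{1-t}\Big)\Big(\frac{dt}{t}\Big)^{k_r-1}\cdots\Big(\frac{dt}{1-t}\Big)\Big(\frac{dt}{t}\Big)^{k_1-1},$$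 where the leftmost form is integrated first (innermost variable, closest to $0$) and the rightmost last. For a composition $\boldsymbol{k}=(k_1,\ldots,k_r)$ with $k_1>1$ and $\beta\in\mathbb{C}\setminus\{0,-1,-2,\ldots\}$, the Hurwitz-type multiple zeta star value is $$\zeta^\star(\boldsymbol{k};\beta)=\sum_{n_1\ge\cdots\ge n_r>0}\frac{1}{(n_1+\beta-1)^{k_1}\cdots(n_r+\beta-1)^{k_r}},$$ the sum being over positive integers. Complex powers of positive reals are $y^\alpha=\exp(\alpha\log y)$ with the real logarithm.
   Formalization: The integral diverges when Re α ≥ 1; for such α it is read as the value of its analytic continuation from Re α < 1 to the complex numbers outside ℕ, while for Re α < 1 it is the literal improper integral. *)

(* Defs.v *)
From Stdlib Require Import Reals Arith Lia Sorted.
From Coquelicot Require Import Coquelicot.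
From Stdlib Require Import List.
Import ListNotations.
Open Scope R_scope.

(** * Compositions *)

Definition is_composition (k : list nat) : Prop :=
  k <> [] /\ Forall (fun x => (1 <= x)%nat) k.

Definition weight (k : list nat) : nat := list_sum k.

Fixpoint partial_sums (a : nat) (k : list nat) : list nat :=
  match k with
  | [] => []
  | x :: l => (a + x)%nat :: partial_sums (a + x) l
  end.

(** [k_1, k_1 + k_2, ..., k_1 + ... + k_(r-1)]: the full sum is dropped. *)
Definition cuts (k : list nat) : list nat := removelast (partial_sums 0 k).

Definition is_hoffman_dual (k k' : list nat) : Prop :=
  is_composition k' /\ weight k' = weight k /\
  forall m : nat, (1 <= m < weight k)%nat -> (In m (cuts k) <-> ~ In m (cuts k')).

Fixpoint gaps (a : nat) (l : list nat) : list nat :=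
  match l with
  | [] => []
  | x :: l' => (x - a)%nat :: gaps x l'
  end.

(** The composition of [weight k] whose proper partial sums are the elements
    of [1, ..., weight k - 1] that are not proper partial sums of [k];
    see [hoffman_dual_spec] and [hoffman_dual_unique]. *)
Definition hoffman_dual (k : list nat) : list nat :=
  gaps 0 (filter (fun m => negb (existsb (Nat.eqb m) (cuts k)))
                 (seq 1 (weight k - 1)) ++ [weight k]).

Definition comp_plus (k : list nat) : list nat :=
  match k with
  | [] => []
  | x :: l => S x :: l
  end.

Lemma partial_sums_gt k : Forall (fun x => (1 <= x)%nat) k ->
  forall a, StronglySorted lt (a :: partial_sums a k).
Proof.
induction 1 as [|x l Hx Hl IH]; intros a; simpl.
- repeat constructor.
- constructor; [apply IH|].
  constructor; [lia|].
  specialize (IH (a + x)%nat). inversion IH as [|? ? _ HF]; subst.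
  eapply Forall_impl; [|exact HF]. simpl; intros; lia.
Qed.

Lemma gaps_partial_sums k : forall a, gaps a (partial_sums a k) = k.
Proof.
induction k as [|x l IH]; intros a; simpl; [reflexivity|].
rewrite IH. f_equal. lia.
Qed.

Lemma partial_sums_gaps l : forall a, StronglySorted lt (a :: l) ->
  partial_sums a (gaps a l) = l /\ Forall (fun x => (1 <= x)%nat) (gaps a l).
Proof.
induction l as [|x l IH]; intros a H; simpl; [split; constructor|].
inversion H as [|? ? H1 H2]; subst. inversion H2; subst.
destruct (IH x H1) as [E F].
replace (a + (x - a))%nat with x by lia. rewrite E.
split; [reflexivity|]. constructor; [lia|exact F].
Qed.

Lemma partial_sums_last k : forall a, k <> [] ->
  last (partial_sums a k) 0%nat = (a + weight k)%nat.
Proof.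
unfold weight. induction k as [|x l IH]; intros a H; [congruence|].
destruct l as [|y l]; [simpl; lia|].
change (last (partial_sums (a + x) (y :: l)) 0%nat = (a + list_sum (x :: y :: l))%nat).
rewrite IH by discriminate. simpl; lia.
Qed.

Lemma partial_sums_cuts k : k <> [] -> partial_sums 0 k = cuts k ++ [weight k].
Proof.
intros H. unfold cuts.
rewrite <- (Nat.add_0_l (weight k)), <- (partial_sums_last k 0 H).
apply app_removelast_last. destruct k; [congruence|discriminate].
Qed.

Lemma StronglySorted_snoc l w : StronglySorted lt l ->
  Forall (fun m => (m < w)%nat) l -> StronglySorted lt (l ++ [w]).
Proof.
induction 1 as [|x l Hl IH Hx]; intros F; simpl; [repeat constructor|].
inversion F; subst. constructor; [auto|].
apply Forall_app; split; [exact Hx|]. repeat constructor; assumption.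
Qed.

Lemma StronglySorted_snoc_inv l w : StronglySorted lt (l ++ [w]) ->
  StronglySorted lt l /\ Forall (fun m => (m < w)%nat) l.
Proof.
induction l as [|x l IH]; simpl; intros H; [split; constructor|].
inversion H as [|? ? H1 H2]; subst. destruct (IH H1) as [A B].
apply Forall_app in H2. destruct H2 as [C D]. inversion D; subst.
split; constructor; assumption.
Qed.

Lemma seq_StronglySorted n : forall s, StronglySorted lt (seq s n).
Proof.
induction n as [|n IH]; intros s; simpl; constructor; [apply IH|].
apply Forall_forall. intros x Hx. apply in_seq in Hx. lia.
Qed.

Lemma filter_StronglySorted f l : StronglySorted lt l -> StronglySorted lt (filter f l).
Proof.
induction 1 as [|x l Hl IH Hx]; simpl; [constructor|].
destruct (f x); [|exact IH]. constructor; [exact IH|].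
apply Forall_forall. intros y Hy. apply filter_In in Hy.
rewrite Forall_forall in Hx. apply Hx, Hy.
Qed.

Lemma StronglySorted_ext l : forall l', StronglySorted lt l -> StronglySorted lt l' ->
  (forall m, In m l <-> In m l') -> l = l'.
Proof.
induction l as [|x l IH]; intros [|y l'] H H' E.
- reflexivity.
- exfalso. apply (proj2 (E y)). now left.
- exfalso. apply (proj1 (E x)). now left.
- inversion H as [|? ? H1 H2]; inversion H' as [|? ? H1' H2']; subst.
  rewrite Forall_forall in H2, H2'.
  assert (x = y) as ->.
  { destruct (proj1 (E x) (or_introl eq_refl)) as [|A]; [congruence|].
    destruct (proj2 (E y) (or_introl eq_refl)) as [|B]; [congruence|].
    specialize (H2 _ B). specialize (H2' _ A). lia. }
  f_equal. apply IH; [assumption..|]. intros m. split; intros Hm.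
  + destruct (proj1 (E m) (or_intror Hm)) as [->|]; [|assumption].
    specialize (H2 _ Hm). lia.
  + destruct (proj2 (E m) (or_intror Hm)) as [->|]; [|assumption].
    specialize (H2' _ Hm). lia.
Qed.

Lemma cuts_sorted k : is_composition k ->
  StronglySorted lt (cuts k) /\ forall m, In m (cuts k) -> (1 <= m < weight k)%nat.
Proof.
intros [H F]. pose proof (partial_sums_gt k F 0) as S.
rewrite (partial_sums_cuts k H) in S. inversion S as [|? ? S1 S2]; subst.
apply StronglySorted_snoc_inv in S1. destruct S1 as [A B].
split; [exact A|]. intros m Hm. rewrite Forall_forall in B, S2.
split; [apply S2, in_or_app; now left|now apply B].
Qed.

Lemma in_cocuts k m :
  In m (filter (fun m => negb (existsb (Nat.eqb m) (cuts k))) (seq 1 (weight k - 1)))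
  <-> (1 <= m < weight k)%nat /\ ~ In m (cuts k).
Proof.
rewrite filter_In, in_seq, Bool.negb_true_iff, <- Bool.not_true_iff_false, existsb_exists.
split.
- intros [H1 H2]. split; [lia|]. intros Hm. apply H2. exists m.
  now rewrite Nat.eqb_refl.
- intros [H1 H2]. split; [lia|]. intros [x [Hx E]].
  apply Nat.eqb_eq in E. now subst.
Qed.

Lemma weight_pos k : is_composition k -> (1 <= weight k)%nat.
Proof.
intros [H F]. destruct k as [|x l]; [congruence|].
inversion F; subst. unfold weight; simpl; lia.
Qed.

Lemma hoffman_dual_spec k : is_composition k -> is_hoffman_dual k (hoffman_dual k).
Proof.
intros Hk. pose proof (weight_pos k Hk) as Hw.
set (c := filter (fun m => negb (existsb (Nat.eqb m) (cuts k))) (seq 1 (weight k - 1))).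
assert (D : hoffman_dual k = gaps 0 (c ++ [weight k])) by reflexivity.
assert (Hc : forall m, In m c <-> (1 <= m < weight k)%nat /\ ~ In m (cuts k))
  by apply in_cocuts.
assert (S : StronglySorted lt (0%nat :: c ++ [weight k])).
{ constructor.
  - apply StronglySorted_snoc; [apply filter_StronglySorted, seq_StronglySorted|].
    apply Forall_forall. intros m Hm. apply Hc in Hm. lia.
  - apply Forall_forall. intros m Hm. apply in_app_or in Hm.
    destruct Hm as [Hm|[<-|[]]]; [apply Hc in Hm; lia|lia]. }
apply partial_sums_gaps in S. rewrite <- D in S. destruct S as [E F].
assert (N : hoffman_dual k <> []).
{ intros N. rewrite N in E. simpl in E. now apply app_cons_not_nil in E. }
rewrite (partial_sums_cuts _ N) in E. apply app_inj_tail in E. destruct E as [E1 E2].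
split; [now split|]. split; [exact E2|]. intros m Hm. rewrite E1, Hc.
destruct (in_dec Nat.eq_dec m (cuts k)); tauto.
Qed.

Lemma hoffman_dual_unique k k' : is_composition k ->
  is_hoffman_dual k k' -> k' = hoffman_dual k.
Proof.
intros Hk [Hk' [W E]]. unfold hoffman_dual.
rewrite <- (gaps_partial_sums k' 0). f_equal.
rewrite (partial_sums_cuts k' (proj1 Hk')), W. f_equal.
destruct (cuts_sorted k' Hk') as [S I].
apply StronglySorted_ext;
  [exact S|apply filter_StronglySorted, seq_StronglySorted|].
intros m. rewrite in_cocuts. split.
- intros Hm. assert (H : (1 <= m < weight k)%nat) by (rewrite <- W; now apply I).
  split; [exact H|]. intros Hm'. now apply (E m H).
- intros [H N]. destruct (in_dec Nat.eq_dec m (cuts k')) as [|N']; [assumption|].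
  exfalso. apply N, (E m H), N'.
Qed.

(** * Multiple polylogarithms on [z < 1] *)

(** The iterated integral.  For [k = k_1 :: k'], the innermost forms are those
    of [k'], followed by one [dt/(1-t)] and then [k_1 - 1] times [dt/t].
    The integrands [f t / t] have [f 0 = 0] and extend continuously to [0];
    their value at the single point [0] does not affect the integral. *)
Fixpoint Li (k : list nat) : R -> R :=
  match k with
  | [] => fun _ => 1
  | k1 :: k' =>
      Nat.iter (k1 - 1) (fun (f : R -> R) z => RInt (fun t => f t / t) 0 z)
        (fun z => RInt (fun t => Li k' t / (1 - t)) 0 z)
  end.

(** * Hurwitz-type multiple zeta-star values *)

(** The sum over [N >= n_1 >= ... >= n_r >= 1]. *)
Fixpoint zeta_star_trunc (k : list nat) (beta : C) (N : nat) : C :=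
  match k with
  | [] => RtoC 1
  | k1 :: k' =>
      sum_n_m (G := C_AbelianMonoid)
        (fun n => (zeta_star_trunc k' beta n / (RtoC (INR n) + beta - RtoC 1) ^ k1)%C) 1 N
  end.

Definition is_zeta_star (k : list nat) (beta v : C) : Prop :=
  filterlim (zeta_star_trunc k beta) eventually (locally (T := C_UniformSpace) v).

(** * The integral *)

(** [exp (alpha * ln y)], for [y > 0]. *)
Definition Rcpow (y : R) (alpha : C) : C :=
  (RtoC (exp (Re alpha * ln y)) * (cos (Im alpha * ln y), sin (Im alpha * ln y)))%C.

Definition integrand (k : list nat) (alpha : C) (x : R) : C :=
  (RtoC (Li k (x / (x - 1))) / (RtoC x * Rcpow (1 - x) alpha))%C.

Definition not_pos_int (alpha : C) : Prop :=
  forall n : nat, (1 <= n)%nat -> alpha <> RtoC (INR n).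

(** Improper integral over [0, 1] of a complex-valued function. *)
Definition is_int01 (f : R -> C) (v : C) : Prop :=
  is_RInt_gen (V := C_R_NormedModule) f (at_right 0) (at_left 1) v.

(** The integral of [integrand k alpha] converges only for [Re alpha < 1]:
    [Li k (x / (x - 1))] grows like a power of [ln (1 - x)] as [x -> 1].
    For the other [alpha] outside the positive integers, the integral denotes
    its analytic continuation, so [is_integral f alpha v] says that the
    integral of [f alpha] over [0, 1], continued from the half-plane
    [Re a < 1] to the complement of the positive integers, has value [v] at
    [alpha].  That complement is open and connected, hence [v] is unique; for
    [Re alpha < 1] it is the value of the convergent integral
    ([is_integral_convergent]). *)
Definition is_integral (f : C -> R -> C) (alpha v : C) : Prop :=
  exists F : C -> C,
    (forall a : C, not_pos_int a -> ex_derive (K := C_AbsRing) (V := C_NormedModule) F a) /\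
    (forall a : C, Re a < 1 -> is_int01 (f a) (F a)) /\
    F alpha = v.

Lemma is_integral_convergent f alpha v :
  is_integral f alpha v -> Re alpha < 1 -> is_int01 (f alpha) v.
Proof. intros [F [_ [H <-]]] Ha. now apply H. Qed.

(* Main.v *)
Require Import Defs.
From Stdlib Require Import Reals Arith Lia Lra.
From Coquelicot Require Import Coquelicot.
From Stdlib Require Import List.
Import ListNotations.
Open Scope R_scope.

(** Put [G(x) = Li k (x / (x - 1))].  In the variable [x] the forms [dt/(1-t)]
    and [dt/t] become [- dx/(1-x)] and [dx/(x(1-x))], so [G' = - H/(1-x)] or
    [G' = H/(x(1-x))], where [H] belongs to the index with one form fewer.
    Integrate [G] by parts against the kernel [sum_(n <= N) Q n (1-x)^(n-1-alpha)].
    In the first case the kernel against [H] has the coefficients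
    [- Q n / (n - alpha)]; in the second, expanding [1/x] in powers of [1-x],
    it has the coefficients [sum_(m <= n) Q m / (m - alpha)], up to a remainder
    that is [O(N^(-1/2))] after integration as long as [Q n = O(n^(1/2))].
    Starting from [Q = 1], the successive coefficients build up the truncated
    zeta-star value of the dual index.  The continuation in [alpha] is the
    zeta-star series itself, whose terms and their derivatives in [alpha] are
    dominated, locally uniformly, by [n^(-3/2)]. *)

(** * The Hoffman dual of the reversal *)

(** The forms are stripped off one at a time from the outside, which is the induction
    [composition_ind]: prepending [1] stands for [dt/(1-t)], raising the head for [dt/t]. Each
    stripping, and also the last integration against the constant [Li [] = 1], divides once by
    [n - alpha]. That makes one division more than the weight of [k], whence the extra unit in
    [comp_plus]. Only [dt/t] opens a new summation index and only [dt/(1-t)] changes the sign; the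
    first fact exchanges the roles of cuts and non-cuts, the second gives the factor (-1)^r. The
    cut-off at [N] keeps every identity finite, so that sum and integral are never interchanged; the
    price is a remainder to be controlled with constants independent of [N]. The growth rate n^(1/2)
    is chosen because sqrt(n)/n sums again to O(sqrt(n)): the bound reproduces itself without any
    count of logarithms, while sqrt(N) times 1/N, the integral of (1-x)^(N-1), still tends to 0. *)

Lemma composition_ind (P : list nat -> Prop) :
  P [] ->
  (forall k, Forall (fun x => (1 <= x)%nat) k -> P k -> P (1%nat :: k)) ->
  (forall j k, Forall (fun x => (1 <= x)%nat) k -> P (S j :: k) -> P (S (S j) :: k)) ->
  forall k, Forall (fun x => (1 <= x)%nat) k -> P k.
Proof.
intros H0 H1 H2 k Hk. induction Hk as [|x l Hx Hl IH]; [exact H0|].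
destruct x as [|j]; [lia|]. clear Hx. induction j as [|j IHj]; auto.
Qed.

(** The value [[1]] on the empty list lets the recursion of [rev_dual] start at the empty
    composition. *)
Fixpoint inc_last (l : list nat) : list nat :=
  match l with
  | [] => [1%nat]
  | [x] => [S x]
  | x :: l' => x :: inc_last l'
  end.

(** [hoffman_dual (rev k)], built up along [k] from its last entry. *)
Fixpoint rev_dual (k : list nat) : list nat :=
  match k with
  | [] => []
  | k1 :: k' => inc_last (rev_dual k') ++ repeat 1%nat (k1 - 1)
  end.

(** Starting from [[1]] instead of [[]] leaves one extra unit in the first entry. Unlike
    [comp_plus (rev_dual k)], this is also the right index for empty [k], where the induction on the
    integral begins. *)
Fixpoint rev_dual_plus (k : list nat) : list nat :=
  match k with
  | [] => [1%nat]
  | k1 :: k' => inc_last (rev_dual_plus k') ++ repeat 1%nat (k1 - 1)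
  end.

Lemma inc_last_snoc l x : inc_last (l ++ [x]) = l ++ [S x].
Proof.
induction l as [|y l IH]; [reflexivity|].
simpl. rewrite IH. now destruct l.
Qed.

Lemma inc_last_neq_nil l : inc_last l <> [].
Proof. destruct l as [|x [|y l]]; discriminate. Qed.

Lemma repeat_one_snoc (j : nat) : repeat 1%nat (S j) = repeat 1%nat j ++ [1%nat].
Proof. induction j as [|j IH]; [reflexivity|]. simpl in *. now rewrite IH at 1. Qed.

Lemma rev_dual_SS j k : rev_dual (S (S j) :: k) = rev_dual (S j :: k) ++ [1%nat].
Proof.
cbn [rev_dual]. replace (S (S j) - 1)%nat with (S j) by lia.
replace (S j - 1)%nat with j by lia. now rewrite repeat_one_snoc, app_assoc.
Qed.

Lemma rev_dual_plus_SS j k :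
  rev_dual_plus (S (S j) :: k) = rev_dual_plus (S j :: k) ++ [1%nat].
Proof.
cbn [rev_dual_plus]. replace (S (S j) - 1)%nat with (S j) by lia.
replace (S j - 1)%nat with j by lia. now rewrite repeat_one_snoc, app_assoc.
Qed.

Lemma rev_dual_plus_one k : rev_dual_plus (1%nat :: k) = inc_last (rev_dual_plus k).
Proof. cbn. now rewrite app_nil_r. Qed.

Lemma rev_dual_neq_nil k : k <> [] -> rev_dual k <> [].
Proof.
destruct k as [|x k]; [easy|]. intros _ E. simpl in E.
apply app_eq_nil in E. now apply (inc_last_neq_nil (rev_dual k)).
Qed.

Lemma rev_neq_nil (k : list nat) : k <> [] -> rev k <> [].
Proof. intros N E. apply N. now rewrite <- (rev_involutive k), E. Qed.

Lemma comp_plus_app l l' : l <> [] -> comp_plus (l ++ l') = comp_plus l ++ l'.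
Proof. now destruct l. Qed.

(** [comp_plus] acts on the first entry and [inc_last] on the last, so they commute on nonempty
    lists, a singleton included. *)
Lemma rev_dual_plus_comp_plus k : k <> [] -> rev_dual_plus k = comp_plus (rev_dual k).
Proof.
induction k as [|x k IH]; [easy|]. intros _. cbn [rev_dual rev_dual_plus].
rewrite comp_plus_app by apply inc_last_neq_nil. f_equal.
destruct k as [|y k]; [reflexivity|]. rewrite IH by easy.
assert (N : rev_dual (y :: k) <> []) by now apply rev_dual_neq_nil.
destruct (rev_dual (y :: k)) as [|z [|z' l]]; [easy|reflexivity|reflexivity].
Qed.

Lemma weight_app l l' : weight (l ++ l') = (weight l + weight l')%nat.
Proof. unfold weight. apply list_sum_app. Qed.

Lemma weight_rev l : weight (rev l) = weight l.
Proof.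
induction l as [|x l IH]; [reflexivity|]. simpl rev. rewrite weight_app, IH.
unfold weight; simpl; lia.
Qed.

Lemma partial_sums_app a l l' :
  partial_sums a (l ++ l') = partial_sums a l ++ partial_sums (a + weight l) l'.
Proof.
revert a. induction l as [|x l IH]; intros a; simpl.
- unfold weight; simpl. now rewrite Nat.add_0_r.
- rewrite IH. do 2 f_equal. unfold weight; simpl. now rewrite Nat.add_assoc.
Qed.

Lemma cuts_snoc l x : cuts (l ++ [x]) = partial_sums 0 l.
Proof. unfold cuts. rewrite partial_sums_app. simpl. apply removelast_last. Qed.

Lemma in_cuts_snoc l x m : l <> [] -> In m (cuts (l ++ [x])) <-> In m (cuts l) \/ m = weight l.
Proof.
intros H. rewrite cuts_snoc, partial_sums_cuts, in_app_iff by assumption.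
simpl. intuition congruence.
Qed.

Lemma inc_last_composition l : Forall (fun x => (1 <= x)%nat) l -> is_composition (inc_last l).
Proof.
intros H. split; [apply inc_last_neq_nil|].
induction H as [|x l Hx Hl IH]; [repeat constructor|].
destruct l; simpl in *; constructor; auto; lia.
Qed.

Lemma rev_dual_pos k : Forall (fun x => (1 <= x)%nat) (rev_dual k).
Proof.
induction k as [|x k IH]; simpl; [constructor|].
apply Forall_app; split; [now apply inc_last_composition|].
apply Forall_forall. intros y Hy. apply repeat_spec in Hy. lia.
Qed.

Lemma weight_inc_last l : weight (inc_last l) = S (weight l).
Proof.
induction l as [|x l IH]; [reflexivity|]. unfold weight in *.
destruct l as [|y l]; [simpl; lia|].
change (list_sum (x :: inc_last (y :: l)) = S (list_sum (x :: y :: l))).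
simpl in *. rewrite IH. lia.
Qed.

Lemma cuts_inc_last l : cuts (inc_last l) = cuts l.
Proof.
destruct l as [|x l] using rev_ind; [reflexivity|].
now rewrite inc_last_snoc, !cuts_snoc.
Qed.

Lemma weight_rev_dual k : Forall (fun x => (1 <= x)%nat) k -> weight (rev_dual k) = weight k.
Proof.
revert k. refine (composition_ind (fun k => weight (rev_dual k) = weight k) _ _ _); [reflexivity| |].
- intros k _ IH. simpl. rewrite app_nil_r, weight_inc_last, IH. reflexivity.
- intros j k _ IH. rewrite rev_dual_SS, weight_app, IH. unfold weight; simpl. lia.
Qed.

(** Each step of the induction raises the weight by one and adds one position, the old weight.
    Prepending [1] makes it a cut of the reversal, while the dual only lengthens its last part;
    raising the head lengthens the last part of the reversal, while the dual gets a new part [1] and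
    hence the cut. *)
Lemma rev_dual_cuts k : Forall (fun x => (1 <= x)%nat) k ->
  forall m : nat, (1 <= m < weight k)%nat -> (In m (cuts (rev k)) <-> ~ In m (cuts (rev_dual k))).
Proof.
revert k. refine (composition_ind (fun k => forall m : nat, (1 <= m < weight k)%nat ->
  (In m (cuts (rev k)) <-> ~ In m (cuts (rev_dual k)))) _ _ _).
- intros m H. unfold weight in H; simpl in H. lia.
- intros k Hk IH m Hm. simpl. rewrite app_nil_r, cuts_inc_last.
  destruct k as [|y k'] eqn:E; [unfold weight in Hm; simpl in Hm; lia|]. rewrite <- E in *.
  assert (N : k <> []) by now rewrite E.
  rewrite in_cuts_snoc by (now apply rev_neq_nil).
  rewrite weight_rev. change (weight (1%nat :: k)) with (S (weight k)) in Hm.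
  destruct (Nat.eq_dec m (weight k)) as [->|D].
  + split; [|auto]. intros _ A.
    apply cuts_sorted in A; [rewrite (weight_rev_dual k Hk) in A; lia|].
    split; [now apply rev_dual_neq_nil|apply rev_dual_pos].
  + rewrite <- IH by lia. tauto.
- intros j k Hk IH m Hm. rewrite rev_dual_SS.
  rewrite in_cuts_snoc by now apply rev_dual_neq_nil.
  rewrite weight_rev_dual by (constructor; [lia|assumption]).
  simpl rev in *. rewrite cuts_snoc in *.
  change (weight (S (S j) :: k)) with (S (weight (S j :: k))) in Hm.
  destruct (Nat.eq_dec m (weight (S j :: k))) as [->|D].
  + split; [|tauto]. intros A. exfalso.
    assert (H : ~ In (weight (S j :: k)) (cuts (rev k ++ [S j]))).
    { intros B. apply cuts_sorted in B.
      - rewrite weight_app, weight_rev in B. unfold weight in B; simpl in B. lia.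
      - split; [intros C; symmetry in C; now apply app_cons_not_nil in C|].
        apply Forall_app; split; [now apply Forall_rev|constructor; [lia|constructor]]. }
    rewrite cuts_snoc in H. now apply H.
  + rewrite IH by lia. tauto.
Qed.

Lemma comp_plus_hoffman_dual_rev k : is_composition k ->
  comp_plus (hoffman_dual (rev k)) = rev_dual_plus k.
Proof.
intros [N Hk]. rewrite rev_dual_plus_comp_plus by assumption. f_equal. symmetry.
apply hoffman_dual_unique.
- split; [now apply rev_neq_nil|now apply Forall_rev].
- split; [split; [now apply rev_dual_neq_nil|apply rev_dual_pos]|].
  rewrite weight_rev, weight_rev_dual by assumption. split; [reflexivity|].
  now apply rev_dual_cuts.
Qed.

(** * Finite sums and series *)

Definition csum (f : nat -> C) (N : nat) : C := sum_n_m (G := C_AbelianMonoid) f 1 N.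

Definition rsum (f : nat -> R) (N : nat) : R := sum_n_m (G := R_AbelianMonoid) f 1 N.

Lemma csum_0 f : csum f 0 = RtoC 0.
Proof. unfold csum. now rewrite sum_n_m_zero by lia. Qed.

Lemma csum_S f N : csum f (S N) = (csum f N + f (S N))%C.
Proof. unfold csum. now rewrite sum_n_Sm by lia. Qed.

Lemma rsum_0 f : rsum f 0 = 0.
Proof. unfold rsum. now rewrite sum_n_m_zero by lia. Qed.

Lemma rsum_S f N : rsum f (S N) = rsum f N + f (S N).
Proof. unfold rsum. now rewrite sum_n_Sm by lia. Qed.

Lemma csum_ext f g N : (forall n, (1 <= n <= N)%nat -> f n = g n) -> csum f N = csum g N.
Proof. intros H. apply sum_n_m_ext_loc. exact H. Qed.

Lemma rsum_le f g N : (forall n, (1 <= n <= N)%nat -> f n <= g n) -> rsum f N <= rsum g N.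
Proof.
induction N as [|N IH]; intros H; [rewrite !rsum_0; lra|].
rewrite !rsum_S. apply Rplus_le_compat; [apply IH; intros; apply H|apply H]; lia.
Qed.

Lemma rsum_scal c f N : rsum (fun n => c * f n) N = c * rsum f N.
Proof. induction N as [|N IH]; [rewrite !rsum_0|rewrite !rsum_S, IH]; ring. Qed.

Lemma csum_scal c f N : csum (fun n => (c * f n)%C) N = (c * csum f N)%C.
Proof. induction N as [|N IH]; [rewrite !csum_0|rewrite !csum_S, IH]; ring. Qed.

Lemma csum_minus f g N : csum (fun n => (f n - g n)%C) N = (csum f N - csum g N)%C.
Proof. induction N as [|N IH]; [rewrite !csum_0|rewrite !csum_S, IH]; ring. Qed.

Lemma Cmod_csum_le f g N :
  (forall n, (1 <= n <= N)%nat -> Cmod (f n) <= g n) -> Cmod (csum f N) <= rsum g N.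
Proof.
induction N as [|N IH]; intros H; [rewrite csum_0, rsum_0, Cmod_0; lra|].
rewrite csum_S, rsum_S. eapply Rle_trans; [apply Cmod_triangle|].
apply Rplus_le_compat; [apply IH; intros; apply H|apply H]; lia.
Qed.

Lemma INR_ge_1 n : (1 <= n)%nat -> 1 <= INR n.
Proof. intros H. apply (le_INR 1 n) in H. exact H. Qed.

Lemma sqrt_INR_ge_1 n : (1 <= n)%nat -> 1 <= sqrt (INR n).
Proof. intros H. rewrite <- sqrt_1. apply sqrt_le_1_alt. now apply INR_ge_1. Qed.

Lemma rsum_inv_sqrt_le N : rsum (fun n => / sqrt (INR n)) N <= 2 * sqrt (INR N).
Proof.
induction N as [|N IH]; [rewrite rsum_0; simpl; rewrite sqrt_0; lra|].
rewrite rsum_S.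
assert (Ha : 0 <= INR N) by apply pos_INR.
assert (Hb : 1 <= sqrt (INR (S N))) by (apply sqrt_INR_ge_1; lia).
assert (Ea : sqrt (INR N) * sqrt (INR N) = INR N) by now apply sqrt_sqrt.
assert (Eb : sqrt (INR (S N)) * sqrt (INR (S N)) = INR N + 1)
  by (rewrite sqrt_sqrt, S_INR; [reflexivity|apply pos_INR]).
set (a := sqrt (INR N)) in *. set (b := sqrt (INR (S N))) in *.
(* Since (b - a)(b + a) = 1 and a <= b, the right-hand side is 2/(a + b) >= 1/b; the sum
   telescopes. *)
enough (/ b <= 2 * (b - a)) by lra.
apply Rmult_le_reg_l with b; [lra|]. rewrite Rinv_r by lra. nra.
Qed.

Lemma rsum_inv_pow_three_halves_le N :
  rsum (fun n => / (INR n * sqrt (INR n))) N <= 3.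
Proof.
destruct N as [|N]; [rewrite rsum_0; lra|].
(* The sharpened bound telescopes and is an equality for a single term. With a, b the consecutive
   square roots, the increment needs 1/b^3 <= 2/a - 2/b, which by (b - a)(b + a) = 1 amounts to a(a
   + b) <= 2b^2. *)
enough (H : rsum (fun n => / (INR n * sqrt (INR n))) (S N) <= 3 - 2 / sqrt (INR (S N))).
{ assert (1 <= sqrt (INR (S N))) by (apply sqrt_INR_ge_1; lia).
  assert (0 < 2 / sqrt (INR (S N))) by (apply Rdiv_lt_0_compat; lra). lra. }
induction N as [|N IH].
- rewrite rsum_S, rsum_0. simpl. rewrite sqrt_1, Rmult_1_l. lra.
- rewrite rsum_S.
  assert (Ha : 1 <= sqrt (INR (S N))) by (apply sqrt_INR_ge_1; lia).
  assert (Hb : 1 <= sqrt (INR (S (S N)))) by (apply sqrt_INR_ge_1; lia).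
  assert (Ea : sqrt (INR (S N)) * sqrt (INR (S N)) = INR (S N)) by (apply sqrt_sqrt, pos_INR).
  assert (Eb : sqrt (INR (S (S N))) * sqrt (INR (S (S N))) = INR (S (S N)))
    by (apply sqrt_sqrt, pos_INR).
  rewrite <- Eb at 1. pose proof (S_INR (S N)) as E. rewrite <- Eb, <- Ea in E.
  set (a := sqrt (INR (S N))) in *. set (b := sqrt (INR (S (S N)))) in *.
  assert (Hab : a <= b) by (apply Rsqr_incr_0; unfold Rsqr; nra).
  enough (/ (b * b * b) <= 2 / a - 2 / b) by lra.
  replace (2 / a - 2 / b) with (/ (b * b * b) + (2 * b * b * (b - a) - a) / (a * b * b * b))
    by (field; lra).
  enough (0 <= (2 * b * b * (b - a) - a) / (a * b * b * b)) by lra.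
  apply Rdiv_le_0_compat; [|apply Rmult_lt_0_compat; [nra|lra]].
  assert (E2 : (b - a) * (b + a) = 1) by nra.
  apply Rmult_le_reg_r with (b + a); [lra|]. rewrite Rmult_0_l.
  replace ((2 * b * b * (b - a) - a) * (b + a))
    with (2 * b * b * ((b - a) * (b + a)) - a * (b + a)) by ring.
  rewrite E2. nra.
Qed.

(** Balls of [C_UniformSpace] are coordinatewise. Passing to [Cmod] costs a factor [sqrt 2 < 2],
    which explains the radius [eps / 2]. *)
Lemma filterlim_eventually_C (u : nat -> C) (l : C) :
  filterlim u eventually (locally (T := C_UniformSpace) l) <->
  forall eps, 0 < eps -> exists N, forall n, (N <= n)%nat -> Cmod (u n - l)%C < eps.
Proof.
split.
- intros H eps He. apply (filterlim_locally (U := C_UniformSpace)) with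
    (eps := mkposreal (eps / 2) (is_pos_div_2 (mkposreal eps He))) in H.
  destruct H as [N H]. exists N. intros n Hn. specialize (H n Hn).
  destruct H as [H1 H2]. change (Rabs (fst (u n) - fst l) < eps / 2) in H1.
  change (Rabs (snd (u n) - snd l) < eps / 2) in H2.
  eapply Rle_lt_trans; [apply Cmod_2Rmax|]. simpl.
  assert (S2 : sqrt 2 < 2).
  { rewrite <- (sqrt_square 2) at 2 by lra. apply sqrt_lt_1_alt. lra. }
  assert (P2 : 0 < sqrt 2) by (apply sqrt_lt_R0; lra).
  assert (M : Rmax (Rabs (fst (u n) + - fst l)) (Rabs (snd (u n) + - snd l)) < eps / 2)
    by now apply Rmax_lub_lt.
  apply Rle_lt_trans with (sqrt 2 * (eps / 2)); [apply Rmult_le_compat_l; lra|].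
  nra.
- intros H. apply (filterlim_locally (U := C_UniformSpace)). intros eps.
  destruct (H eps (cond_pos eps)) as [N HN]. exists N. intros n Hn.
  specialize (HN n Hn). pose proof (Rmax_Cmod (u n - l)%C) as M. simpl in M.
  split.
  + change (Rabs (fst (u n) - fst l) < eps).
    eapply Rle_lt_trans; [|exact HN]. eapply Rle_trans; [apply Rmax_l|exact M].
  + change (Rabs (snd (u n) - snd l) < eps).
    eapply Rle_lt_trans; [|exact HN]. eapply Rle_trans; [apply Rmax_r|exact M].
Qed.

Lemma csum_lim_exists (f : nat -> C) (w : nat -> R) (B : R) :
  (forall n, (1 <= n)%nat -> Cmod (f n) <= w n) -> (forall N, rsum w N <= B) ->
  exists l, filterlim (csum f) eventually (locally (T := C_UniformSpace) l).
Proof.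
intros Hf Hw.
(* [sum_n] starts at index 0 and [csum] at 1, hence the shift throughout. *)
assert (S1 : forall N, sum_n (fun n => w (S n)) N = rsum w (S N)).
{ intros N. unfold rsum, sum_n. rewrite sum_n_m_S. reflexivity. }
assert (S2 : forall N, sum_n (fun n => f (S n) : C_AbelianMonoid) N = csum f (S N)).
{ intros N. unfold csum, sum_n. rewrite sum_n_m_S. reflexivity. }
assert (X : ex_series (fun n => w (S n))).
{ destruct (ex_finite_lim_seq_incr (sum_n (fun n => w (S n))) B) as [l Hl].
  - intros n. rewrite !S1, (rsum_S _ (S n)).
    pose proof (Hf (S (S n)) ltac:(lia)). pose proof (Cmod_ge_0 (f (S (S n)))). lra.
  - intros n. now rewrite S1.
  - exists l. exact Hl. }
destruct (ex_series_le (K := C_AbsRing) (V := C_CompleteNormedModule) (fun n => f (S n)) (fun n => w (S n)))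
  as [l Hl].
- intros n. apply Hf. lia.
- exact X.
- exists l. apply filterlim_eventually_C. intros eps He.
  apply (proj1 (filterlim_eventually_C _ l)) with (eps := eps) in Hl; [|exact He].
  destruct Hl as [N HN]. exists (S N). intros n Hn. destruct n as [|n]; [lia|].
  specialize (HN n ltac:(lia)). now rewrite S2 in HN.
Qed.

(** * Zeta-star sums as functions of [alpha] *)

(** [zeta_star_trunc] with denominators [d n], and with a weight [Q n] on the
    smallest summation index. *)
Fixpoint star_sum (d Q : nat -> C) (k : list nat) (N : nat) : C :=
  match k with
  | [] => Q N
  | k1 :: k' => csum (fun n => star_sum d Q k' n / d n ^ k1)%C N
  end.

Lemma star_sum_ext d Q Q' k N : (forall n, (n <= N)%nat -> Q n = Q' n) -> star_sum d Q k N = star_sum d Q' k N.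
Proof.
revert N. induction k as [|x k IH]; intros N H; simpl; [now apply H|].
apply csum_ext. intros n Hn. rewrite (IH n); [reflexivity|].
intros m Hm. apply H. lia.
Qed.

Lemma star_sum_app d Q k l N : star_sum d Q (k ++ l) N = star_sum d (star_sum d Q l) k N.
Proof.
revert N. induction k as [|x k IH]; intros N; simpl; [reflexivity|].
apply csum_ext. intros n _. now rewrite IH.
Qed.

(** The combinatorial side of stripping [dt/t]: a new smallest summation index is absorbed into the
    weight. *)
Lemma star_sum_snoc_one d Q k N :
  star_sum d Q (k ++ [1%nat]) N = star_sum d (csum (fun n => Q n / d n)%C) k N.
Proof.
rewrite star_sum_app. apply star_sum_ext. intros n _. simpl.
apply csum_ext. intros m _. now rewrite Cmult_1_r.
Qed.

(** The combinatorial side of stripping [dt/(1-t)]: no new index, only one more denominator at the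
    smallest one. For empty [k], [inc_last] would create a summation instead. *)
Lemma star_sum_inc_last d Q k N : (forall n, (1 <= n)%nat -> d n <> RtoC 0) -> k <> [] ->
  star_sum d Q (inc_last k) N = star_sum d (fun n => Q n / d n)%C k N.
Proof.
intros Hd. destruct k as [|x k] using rev_ind; [easy|]. intros _.
rewrite inc_last_snoc, !star_sum_app. apply star_sum_ext. intros n _. simpl.
apply csum_ext. intros m Hm. field. split; (apply Hd || apply Cpow_nz, Hd); lia.
Qed.

(** Uniformly on the disc of radius [delta] around [a0], [f n] is bounded by
    [K * w n] and agrees with its first-order expansion at [a0] up to
    [K * w n * |a - a0|^2]. *)
Definition tame (a0 : C) (delta : R) (f : nat -> C -> C) (w : nat -> R) : Prop :=
  exists (K : R) (d : nat -> C), 0 <= K /\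
    forall n, (1 <= n)%nat -> Cmod (d n) <= K * w n /\
    forall a, Cmod (a - a0) <= delta ->
      Cmod (f n a) <= K * w n /\
      Cmod (f n a - f n a0 - (a - a0) * d n) <= K * w n * Cmod (a - a0) ^ 2.

Lemma tame_weight a0 delta f v w c : 0 <= c ->
  (forall n, (1 <= n)%nat -> v n <= c * w n) -> tame a0 delta f v -> tame a0 delta f w.
Proof.
intros Hc Hvw [K [d [HK H]]]. exists (K * c), d. split; [now apply Rmult_le_pos|].
intros n Hn. specialize (H n Hn) as [H1 H2].
assert (L : K * v n <= K * c * w n).
{ rewrite Rmult_assoc. apply Rmult_le_compat_l; auto. }
split; [lra|]. intros a Ha. specialize (H2 a Ha) as [H3 H4]. split; [lra|].
eapply Rle_trans; [exact H4|]. apply Rmult_le_compat_r; [apply pow2_ge_0|exact L].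
Qed.

Lemma tame_ext a0 delta f g w : 0 <= delta ->
  (forall n a, (1 <= n)%nat -> Cmod (a - a0) <= delta -> f n a = g n a) ->
  tame a0 delta f w -> tame a0 delta g w.
Proof.
intros Hd E [K [d [HK H]]]. exists K, d. split; [exact HK|].
intros n Hn. specialize (H n Hn) as [H1 H2]. split; [exact H1|].
intros a Ha. rewrite <- !E; auto.
replace (a0 - a0)%C with (RtoC 0) by ring. now rewrite Cmod_0.
Qed.

Lemma tame_const a0 delta c : tame a0 delta (fun _ _ => c) (fun _ => 1).
Proof.
exists (Cmod c), (fun _ => RtoC 0). split; [apply Cmod_ge_0|].
intros n _. rewrite Cmod_0. pose proof (Cmod_ge_0 c).
split; [lra|]. intros a _. split; [lra|].
replace (c - c - (a - a0) * RtoC 0)%C with (RtoC 0) by ring. rewrite Cmod_0.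
apply Rmult_le_pos; [lra|apply pow2_ge_0].
Qed.

Lemma tame_mult a0 delta f g v w : 0 <= delta <= 1 ->
  tame a0 delta f v -> tame a0 delta g w ->
  tame a0 delta (fun n a => f n a * g n a)%C (fun n => v n * w n).
Proof.
intros Hdelta [K [d [HK H]]] [L [e [HL G]]].
(* Leibniz rule. The remainder splits into the remainder of [f] times [g], [f] times the remainder
   of [g], and a cross term with the increment of [g]. They cost 1, 1 and 2: the increment is at
   most twice the bound times |a - a0|, because |a - a0|^2 <= |a - a0| when [delta <= 1]. *)
exists (4 * (K * L)), (fun n => d n * g n a0 + f n a0 * e n)%C.
split; [apply Rmult_le_pos; [lra|now apply Rmult_le_pos]|].
intros n Hn. specialize (H n Hn) as [H1 H2]. specialize (G n Hn) as [G1 G2].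
assert (Z : Cmod (a0 - a0) <= delta)
  by (replace (a0 - a0)%C with (RtoC 0) by ring; rewrite Cmod_0; lra).
destruct (H2 a0 Z) as [H3 _]. destruct (G2 a0 Z) as [G3 _].
replace (4 * (K * L) * (v n * w n)) with (4 * ((K * v n) * (L * w n))) by ring.
set (B := K * v n) in *. set (D := L * w n) in *.
assert (M : forall x y : C, Cmod x <= B -> Cmod y <= D -> Cmod (x * y) <= B * D).
{ intros x y Hx Hy. rewrite Cmod_mult.
  apply Rmult_le_compat; auto using Cmod_ge_0. }
assert (P : 0 <= B * D).
{ eapply Rle_trans; [apply (Cmod_ge_0 (d n * e n)%C)|auto]. }
split.
- eapply Rle_trans; [apply Cmod_triangle|].
  pose proof (M _ _ H1 G3). pose proof (M _ _ H3 G1). lra.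
- intros a Ha. destruct (H2 a Ha) as [H4 H5]. destruct (G2 a Ha) as [G4 G5].
  split; [pose proof (M _ _ H4 G4); lra|].
  set (h := Cmod (a - a0)) in *.
  assert (Hh : 0 <= h <= 1) by (split; [apply Cmod_ge_0|lra]).
  assert (B0 : 0 <= B) by (eapply Rle_trans; [apply Cmod_ge_0|exact H1]).
  assert (D0 : 0 <= D) by (eapply Rle_trans; [apply Cmod_ge_0|exact G1]).
  assert (G6 : Cmod (g n a - g n a0) <= 2 * D * h).
  { replace (g n a - g n a0)%C
      with ((g n a - g n a0 - (a - a0) * e n) + (a - a0) * e n)%C by ring.
    eapply Rle_trans; [apply Cmod_triangle|]. rewrite Cmod_mult. fold h.
    assert (h * Cmod (e n) <= h * D) by (apply Rmult_le_compat_l; lra).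
    assert (D * h ^ 2 <= D * h) by (apply Rmult_le_compat_l; [exact D0|simpl; nra]). lra. }
  replace (f n a * g n a - f n a0 * g n a0 - (a - a0) * (d n * g n a0 + f n a0 * e n))%C
    with ((f n a - f n a0 - (a - a0) * d n) * g n a
          + f n a0 * (g n a - g n a0 - (a - a0) * e n)
          + (a - a0) * d n * (g n a - g n a0))%C by ring.
  eapply Rle_trans; [apply Cmod_triangle|].
  eapply Rle_trans; [apply Rplus_le_compat_r, Cmod_triangle|].
  rewrite !Cmod_mult. fold h.
  assert (T1 : Cmod (f n a - f n a0 - (a - a0) * d n) * Cmod (g n a) <= B * h ^ 2 * D)
    by (apply Rmult_le_compat; auto using Cmod_ge_0).
  assert (T2 : Cmod (f n a0) * Cmod (g n a - g n a0 - (a - a0) * e n) <= B * (D * h ^ 2))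
    by (apply Rmult_le_compat; auto using Cmod_ge_0).
  assert (T3 : h * Cmod (d n) * Cmod (g n a - g n a0) <= h * B * (2 * D * h)).
  { apply Rmult_le_compat; auto using Cmod_ge_0.
    - apply Rmult_le_pos; [lra|apply Cmod_ge_0].
    - apply Rmult_le_compat_l; lra. }
  simpl in *. lra.
Qed.

Lemma tame_csum a0 delta f w :
  tame a0 delta f w ->
  tame a0 delta (fun N a => csum (fun n => f n a) N) (fun N => rsum w N).
Proof.
intros [K [d [HK H]]]. exists K, (csum d). split; [exact HK|].
intros N _. rewrite <- rsum_scal. split.
- apply Cmod_csum_le. intros n Hn. apply H. lia.
- intros a Ha. split.
  + apply Cmod_csum_le. intros n Hn. apply H; [lia|assumption].
  + rewrite <- csum_scal, <- !csum_minus.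
    rewrite Rmult_comm, <- rsum_scal. apply Cmod_csum_le. intros n Hn.
    rewrite Rmult_comm. apply H; [lia|assumption].
Qed.

Lemma dist_pos_ints_finite (a0 : C) N : not_pos_int a0 ->
  exists m, 0 < m /\ forall n, (1 <= n <= N)%nat -> m <= Cmod (RtoC (INR n) - a0).
Proof.
intros Ha. induction N as [|N [m [Hm IH]]]; [exists 1; split; [lra|intros; lia]|].
assert (P : 0 < Cmod (RtoC (INR (S N)) - a0)).
{ apply Cmod_gt_0. intros E. apply (Ha (S N)); [lia|].
  replace a0 with (RtoC (INR (S N)) - (RtoC (INR (S N)) - a0))%C by ring.
  rewrite E. ring. }
exists (Rmin m (Cmod (RtoC (INR (S N)) - a0))). split; [now apply Rmin_pos|].
intros n Hn. destruct (Nat.eq_dec n (S N)) as [->|D]; [apply Rmin_r|].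
eapply Rle_trans; [apply Rmin_l|]. apply IH. lia.
Qed.

Lemma Cmod_INR n : Cmod (RtoC (INR n)) = INR n.
Proof. rewrite Cmod_R. apply Rabs_pos_eq, pos_INR. Qed.

(** For n > 2(|a0| + 1) and |a - a0| <= 1, |n - a| >= n/2 by the triangle inequality. The finitely
    many smaller [n] keep a distance at least [m] from [a0], hence at least m/2 from [a] when |a -
    a0| <= m/2. *)
Lemma dist_pos_ints (a0 : C) : not_pos_int a0 ->
  exists delta c, 0 < delta <= 1 /\ 0 < c /\
    forall n a, (1 <= n)%nat -> Cmod (a - a0) <= delta ->
      c * INR n <= Cmod (RtoC (INR n) - a).
Proof.
intros Ha. pose proof (Cmod_ge_0 a0) as H0.
destruct (nfloor_ex (2 * (Cmod a0 + 1))) as [N [_ HN]]; [lra|].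
destruct (dist_pos_ints_finite a0 (S N) Ha) as [m [Hm HM]].
assert (PN : 1 <= INR (S N)) by (apply INR_ge_1; lia).
assert (Hc : 0 < m / (2 * INR (S N))) by (apply Rdiv_lt_0_compat; lra).
exists (Rmin 1 (m / 2)), (Rmin (/ 2) (m / (2 * INR (S N)))).
split; [split; [apply Rmin_pos; lra|apply Rmin_l]|].
split; [apply Rmin_pos; lra|].
intros n a Hn Hd.
assert (D1 : Cmod (a - a0) <= 1) by (eapply Rle_trans; [exact Hd|apply Rmin_l]).
assert (D2 : Cmod (a - a0) <= m / 2) by (eapply Rle_trans; [exact Hd|apply Rmin_r]).
assert (Pn : 1 <= INR n) by now apply INR_ge_1.
destruct (le_lt_dec n (S N)) as [L|L].
- apply Rle_trans with (m / (2 * INR (S N)) * INR n);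
    [apply Rmult_le_compat_r; [lra|apply Rmin_r]|].
  apply Rle_trans with (m / 2).
  + apply le_INR in L.
    replace (m / (2 * INR (S N)) * INR n) with (m / 2 * (INR n / INR (S N))) by (field; lra).
    rewrite <- (Rmult_1_r (m / 2)) at 2. apply Rmult_le_compat_l; [lra|].
    apply Rle_div_l; lra.
  + specialize (HM n ltac:(lia)).
    assert (T : Cmod (RtoC (INR n) - a0) <= Cmod (RtoC (INR n) - a) + Cmod (a - a0)).
    { eapply Rle_trans; [|apply Cmod_triangle]. right. f_equal. ring. }
    lra.
- apply Rle_trans with (/ 2 * INR n); [apply Rmult_le_compat_r; [lra|apply Rmin_l]|].
  assert (T : INR n <= Cmod (RtoC (INR n) - a) + (Cmod (a - a0) + Cmod a0)).
  { rewrite <- (Cmod_INR n) at 1.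
    eapply Rle_trans; [|apply Rplus_le_compat_l, Cmod_triangle].
    eapply Rle_trans; [|apply Cmod_triangle]. right. f_equal. ring. }
  apply lt_INR in L. rewrite S_INR in L. lra.
Qed.

Lemma tame_inv a0 delta c : 0 <= delta <= 1 -> 0 < c ->
  (forall n a, (1 <= n)%nat -> Cmod (a - a0) <= delta ->
    c * INR n <= Cmod (RtoC (INR n) - a)) ->
  tame a0 delta (fun n a => / (RtoC (INR n) - a))%C (fun n => / INR n).
Proof.
intros Hd Hc H. set (C1 := / c). assert (HC : 0 < C1) by now apply Rinv_0_lt_compat.
assert (I : forall n a, (1 <= n)%nat -> Cmod (a - a0) <= delta ->
  (RtoC (INR n) - a <> RtoC 0)%C /\ Cmod (/ (RtoC (INR n) - a))%C <= C1 * / INR n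
    /\ Cmod (/ (RtoC (INR n) - a))%C <= C1).
{ intros n a Hn Ha. specialize (H n a Hn Ha). pose proof (INR_ge_1 n Hn) as Pn.
  assert (P : 0 < c * INR n) by (apply Rmult_lt_0_compat; lra).
  assert (B : Cmod (/ (RtoC (INR n) - a))%C <= C1 * / INR n).
  { unfold C1. rewrite Cmod_inv, <- Rinv_mult by (apply Cmod_gt_0; lra). now apply Rinv_le_contravar. }
  split; [apply Cmod_gt_0; lra|]. split; [exact B|].
  eapply Rle_trans; [exact B|]. rewrite <- (Rmult_1_r C1) at 2.
  apply Rmult_le_compat_l; [lra|]. rewrite <- Rinv_1. apply Rinv_le_contravar; lra. }
assert (Z : Cmod (a0 - a0) <= delta)
  by (replace (a0 - a0)%C with (RtoC 0) by ring; rewrite Cmod_0; lra).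
(* The three powers serve the value, the derivative and the remainder in turn. The remainder is
   exactly (a - a0)^2 / ((n - a)(n - a0)^2); one denominator supplies the 1/n, the others are
   bounded by [C1]. *)
exists (C1 + C1 ^ 2 + C1 ^ 3), (fun n => / (RtoC (INR n) - a0) * / (RtoC (INR n) - a0))%C.
split; [simpl; nra|].
intros n Hn. destruct (I n a0 Hn Z) as [N0 [I1 I2]].
assert (Pn : 0 < / INR n) by (apply Rinv_0_lt_compat; pose proof (INR_ge_1 n Hn); lra).
assert (M1 : C1 * / INR n * C1 <= (C1 + C1 ^ 2 + C1 ^ 3) * / INR n).
{ replace (C1 * / INR n * C1) with (C1 ^ 2 * / INR n) by ring.
  apply Rmult_le_compat_r; [lra|]. pose proof (pow_lt C1 3 HC). lra. }
split.
- rewrite Cmod_mult. eapply Rle_trans; [|exact M1].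
  apply Rmult_le_compat; auto using Cmod_ge_0.
- intros a Ha. destruct (I n a Hn Ha) as [N [J1 J2]]. split.
  + eapply Rle_trans; [exact J1|]. apply Rmult_le_compat_r; [lra|].
    pose proof (pow_lt C1 3 HC). pose proof (pow_lt C1 2 HC). lra.
  + replace (/ (INR n - a) - / (INR n - a0) - (a - a0) * (/ (INR n - a0) * / (INR n - a0)))%C
      with (/ (INR n - a) * / (INR n - a0) * / (INR n - a0) * ((a - a0) * (a - a0)))%C
      by (field; split; assumption).
    rewrite !Cmod_mult. replace (Cmod (a - a0) ^ 2) with (Cmod (a - a0) * Cmod (a - a0)) by ring.
    apply Rmult_le_compat_r; [apply Rmult_le_pos; apply Cmod_ge_0|].
    apply Rle_trans with (C1 * / INR n * C1 * C1).
    * repeat apply Rmult_le_compat; auto using Cmod_ge_0; repeat apply Rmult_le_pos; apply Cmod_ge_0.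
    * replace (C1 * / INR n * C1 * C1) with (C1 ^ 3 * / INR n) by ring.
      apply Rmult_le_compat_r; [lra|]. pose proof (pow_lt C1 2 HC). lra.
Qed.

Lemma tame_Cpow a0 delta f w k : 0 <= delta <= 1 ->
  tame a0 delta f w -> tame a0 delta (fun n a => f n a ^ k)%C (fun n => w n ^ k).
Proof.
intros Hd H. induction k as [|k IH]; simpl; [apply tame_const|].
now apply tame_mult.
Qed.

Section ZetaStarTame.

Variables (a0 : C) (delta c : R).
Hypothesis Hdelta : 0 <= delta <= 1.
Hypothesis Hc : 0 < c.
Hypothesis Hdist : forall n a, (1 <= n)%nat -> Cmod (a - a0) <= delta ->
    c * INR n <= Cmod (RtoC (INR n) - a).

Lemma tame_star_sum_term k p :
  tame a0 delta (fun N a => star_sum (fun n => RtoC (INR n) - a)%C (fun _ => RtoC 1) k N)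
    (fun n => sqrt (INR n)) ->
  tame a0 delta (fun n a => star_sum (fun n => RtoC (INR n) - a)%C (fun _ => RtoC 1) k n
      / (RtoC (INR n) - a) ^ p)%C
    (fun n => sqrt (INR n) * (/ INR n) ^ p).
Proof.
intros H.
apply tame_ext with (fun n a => star_sum (fun n => RtoC (INR n) - a)%C (fun _ => RtoC 1) k n
      * (/ (RtoC (INR n) - a)) ^ p)%C; [lra| |].
- intros n a Hn Ha. unfold Cdiv. rewrite Cpow_inv; [reflexivity|].
  apply Cmod_gt_0. specialize (Hdist n a Hn Ha). pose proof (INR_ge_1 n Hn).
  assert (0 < c * INR n) by (apply Rmult_lt_0_compat; lra). lra.
- apply tame_mult; [assumption|exact H|]. apply tame_Cpow; [assumption|].
  now apply tame_inv with c.
Qed.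

(** Dividing a term of size sqrt(n) by at least one power of n leaves n^(-1/2), whose partial sums
    are again O(sqrt(N)). The same weight thus passes through every layer of the nested sum. *)
Lemma tame_star_sum k : Forall (fun x => (1 <= x)%nat) k ->
  tame a0 delta (fun N a => star_sum (fun n => RtoC (INR n) - a)%C (fun _ => RtoC 1) k N)
    (fun n => sqrt (INR n)).
Proof.
induction 1 as [|p k Hp Hk IH]; simpl.
- apply tame_weight with (fun _ => 1) 1; [lra| |apply tame_const].
  intros n Hn. pose proof (sqrt_INR_ge_1 n Hn). lra.
- apply tame_weight with (rsum (fun n => sqrt (INR n) * (/ INR n) ^ p)) 2; [lra| |].
  + intros N HN. eapply Rle_trans; [|apply rsum_inv_sqrt_le].
    apply rsum_le. intros n [Hn _].
    pose proof (sqrt_INR_ge_1 n Hn) as P. pose proof (INR_ge_1 n Hn) as Q.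
    assert (I : 0 < / INR n <= 1).
    { split; [apply Rinv_0_lt_compat; lra|].
      rewrite <- Rinv_1. apply Rinv_le_contravar; lra. }
    destruct p as [|p]; [lia|]. simpl.
    assert (J : (/ INR n) ^ p <= 1)
      by (rewrite <- (pow1 p); apply pow_incr; lra).
    rewrite <- (sqrt_sqrt (INR n)) at 2 by lra.
    rewrite Rinv_mult, <- !Rmult_assoc, Rinv_r, Rmult_1_l by lra.
    rewrite <- (Rmult_1_r (/ sqrt (INR n))) at 2.
    apply Rmult_le_compat_l; [|exact J].
    apply Rlt_le, Rinv_0_lt_compat; lra.
  + apply tame_csum, tame_star_sum_term, IH.
Qed.

(** For the outermost layer, the second power of 1/n turns sqrt(n) into a summable n^(-3/2). *)
Lemma tame_star_sum_summand p k : (2 <= p)%nat -> Forall (fun x => (1 <= x)%nat) k ->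
  tame a0 delta (fun n a => star_sum (fun n => RtoC (INR n) - a)%C (fun _ => RtoC 1) k n
      / (RtoC (INR n) - a) ^ p)%C
    (fun n => / (INR n * sqrt (INR n))).
Proof.
intros Hp Hk.
apply tame_weight with (fun n => sqrt (INR n) * (/ INR n) ^ p) 1;
  [lra| |now apply tame_star_sum_term, tame_star_sum].
intros n Hn. pose proof (sqrt_INR_ge_1 n Hn) as P. pose proof (INR_ge_1 n Hn) as Q.
assert (I : 0 < / INR n <= 1).
{ split; [apply Rinv_0_lt_compat; lra|].
  rewrite <- Rinv_1. apply Rinv_le_contravar; lra. }
destruct p as [|[|p]]; [lia|lia|]. simpl.
assert (J : (/ INR n) ^ p <= 1)
  by (rewrite <- (pow1 p); apply pow_incr; lra).
assert (E : sqrt (INR n) * / INR n = / sqrt (INR n)).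
{ rewrite <- (sqrt_sqrt (INR n)) at 2 by lra. field. lra. }
rewrite <- Rmult_assoc, E, Rmult_1_l, Rinv_mult, (Rmult_comm (/ INR n) (/ sqrt _)).
apply Rmult_le_compat_l; [apply Rlt_le, Rinv_0_lt_compat; lra|].
apply Rle_trans with (/ INR n * 1); [apply Rmult_le_compat_l|]; lra.
Qed.

End ZetaStarTame.

(** * Complex differentiability of dominated series *)

Lemma ex_derive_C_quadratic (F : C -> C) (a0 D : C) (K delta : R) : 0 < delta -> 0 <= K ->
  (forall a, Cmod (a - a0) <= delta ->
    Cmod (F a - F a0 - (a - a0) * D) <= K * Cmod (a - a0) ^ 2) ->
  ex_derive (K := C_AbsRing) (V := C_NormedModule) F a0.
Proof.
intros Hd HK H. exists D. split; [apply is_linear_scal_l|].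
intros x Hx. apply (is_filter_lim_locally_unique (K := C_AbsRing) (V := AbsRing_NormedModule C_AbsRing)) in Hx. subst x. intros eps.
assert (He : 0 < eps / (K + 1)) by (apply Rdiv_lt_0_compat; [apply cond_pos|lra]).
exists (mkposreal (Rmin delta (eps / (K + 1))) (Rmin_pos _ _ Hd He)).
intros a Ha. change (Cmod (a - a0) < Rmin delta (eps / (K + 1))) in Ha.
change (Cmod (F a - F a0 - (a - a0) * D) <= eps * Cmod (a - a0)).
assert (H1 : Cmod (a - a0) < delta) by (eapply Rlt_le_trans; [exact Ha|apply Rmin_l]).
assert (H2 : Cmod (a - a0) < eps / (K + 1)) by (eapply Rlt_le_trans; [exact Ha|apply Rmin_r]).
eapply Rle_trans; [apply H; lra|].
replace (K * Cmod (a - a0) ^ 2) with (K * Cmod (a - a0) * Cmod (a - a0)) by ring.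
apply Rmult_le_compat_r; [apply Cmod_ge_0|].
apply Rlt_div_r in H2; [|lra]. pose proof (Cmod_ge_0 (a - a0)). lra.
Qed.

(** The quadratic remainder of a partial sum is at most K B |a - a0|^2, whatever the number of
    terms, so the bound survives in the limit, with the sum of the [d n] as derivative. At each
    fixed [a] one [N] brings three limits within [eps / 3]. *)
Lemma tame_series_ex_derive a0 delta f w B (F : C -> C) : 0 < delta <= 1 ->
  tame a0 delta f w -> (forall N, rsum w N <= B) ->
  (forall a, Cmod (a - a0) <= delta ->
    filterlim (csum (fun n => f n a)) eventually (locally (T := C_UniformSpace) (F a))) ->
  ex_derive (K := C_AbsRing) (V := C_NormedModule) F a0.
Proof.
intros Hd [K [d [HK H]]] HB HF.
destruct (csum_lim_exists d (fun n => K * w n) (K * B)) as [D HD].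
{ intros n Hn. now apply H. }
{ intros N. rewrite rsum_scal. now apply Rmult_le_compat_l. }
assert (B0 : 0 <= B) by (specialize (HB 0%nat); now rewrite rsum_0 in HB).
assert (Z : Cmod (a0 - a0) <= delta)
  by (replace (a0 - a0)%C with (RtoC 0) by ring; rewrite Cmod_0; lra).
apply ex_derive_C_quadratic with D (K * B) delta; [lra|now apply Rmult_le_pos|].
intros a Ha. apply le_epsilon. intros eps He.
assert (He' : 0 < eps / 3) by lra.
destruct (proj1 (filterlim_eventually_C _ _) HD _ He') as [N1 H1].
destruct (proj1 (filterlim_eventually_C _ _) (HF a Ha) _ He') as [N2 H2].
destruct (proj1 (filterlim_eventually_C _ _) (HF a0 Z) _ He') as [N3 H3].
set (N := (N1 + N2 + N3)%nat).
specialize (H1 N ltac:(unfold N; lia)). specialize (H2 N ltac:(unfold N; lia)).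
specialize (H3 N ltac:(unfold N; lia)).
assert (Q : Cmod (csum (fun n => f n a) N - csum (fun n => f n a0) N - (a - a0) * csum d N)
   <= K * B * Cmod (a - a0) ^ 2).
{ rewrite <- csum_scal, <- !csum_minus.
  apply Rle_trans with (rsum (fun n => Cmod (a - a0) ^ 2 * K * w n) N).
  - apply Cmod_csum_le. intros n [Hn _].
    eapply Rle_trans; [now apply H|]. right. ring.
  - rewrite rsum_scal. rewrite (Rmult_comm (K * B)), <- Rmult_assoc.
    apply Rmult_le_compat_l; [|apply HB].
    apply Rmult_le_pos; [apply pow2_ge_0|exact HK]. }
set (Sa := csum (fun n => f n a) N) in *. set (S0 := csum (fun n => f n a0) N) in *.
set (SD := csum d N) in *.
replace (F a - F a0 - (a - a0) * D)%C
  with ((Sa - S0 - (a - a0) * SD) + (- (Sa - F a) + ((S0 - F a0) + (a - a0) * (SD - D))))%C by ring.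
eapply Rle_trans; [apply Cmod_triangle|]. apply Rplus_le_compat; [exact Q|].
eapply Rle_trans; [apply Cmod_triangle|]. rewrite Cmod_opp.
assert (T : Cmod (S0 - F a0 + (a - a0) * (SD - D)) <= 2 * (eps / 3)); [|lra].
eapply Rle_trans; [apply Cmod_triangle|]. rewrite Cmod_mult.
assert (Cmod (a - a0) * Cmod (SD - D) <= 1 * (eps / 3)); [|lra].
apply Rmult_le_compat; try apply Cmod_ge_0; lra.
Qed.

(** A total limit operator, so that the continuation is given by a formula in [alpha]; its value is
    meaningful only for convergent sequences. *)
Definition climit (u : nat -> C) : C :=
  (real (Lim_seq (fun n => fst (u n))), real (Lim_seq (fun n => snd (u n)))).

Lemma climit_correct (u : nat -> C) (l : C) :
  filterlim u eventually (locally (T := C_UniformSpace) l) -> climit u = l.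
Proof.
intros H. destruct l as [l1 l2]. unfold climit.
rewrite (is_lim_seq_unique _ l1), (is_lim_seq_unique _ l2); [reflexivity| |].
- intros P [e HP]. apply (filterlim_locally (U := C_UniformSpace)) with (eps := e) in H.
  destruct H as [N HN]. exists N. intros n Hn. apply HP. now apply HN.
- intros P [e HP]. apply (filterlim_locally (U := C_UniformSpace)) with (eps := e) in H.
  destruct H as [N HN]. exists N. intros n Hn. apply HP. now apply HN.
Qed.

Lemma star_sum_lim_exists k a : not_pos_int a -> Forall (fun x => (1 <= x)%nat) (tl k) ->
  (2 <= hd 0%nat k)%nat ->
  exists l, filterlim (star_sum (fun n => RtoC (INR n) - a)%C (fun _ => RtoC 1) k)
    eventually (locally (T := C_UniformSpace) l).
Proof.
intros Ha. destruct k as [|p k]; simpl; [lia|]. intros Hk Hp.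
destruct (dist_pos_ints a Ha) as [delta [c [Hd [Hc H]]]].
destruct (tame_star_sum_summand a delta c ltac:(lra) Hc H p k Hp Hk) as [K [d [HK T]]].
apply csum_lim_exists with (fun n => K * / (INR n * sqrt (INR n))) (K * 3).
- intros n Hn. apply (T n Hn).
  replace (a - a)%C with (RtoC 0) by ring. rewrite Cmod_0. lra.
- intros N. rewrite rsum_scal. apply Rmult_le_compat_l; [exact HK|].
  apply rsum_inv_pow_three_halves_le.
Qed.

Lemma star_sum_lim_ex_derive k a (F : C -> C) : not_pos_int a ->
  Forall (fun x => (1 <= x)%nat) (tl k) -> (2 <= hd 0%nat k)%nat ->
  (forall a, not_pos_int a ->
    filterlim (star_sum (fun n => RtoC (INR n) - a)%C (fun _ => RtoC 1) k)
    eventually (locally (T := C_UniformSpace) (F a))) ->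
  ex_derive (K := C_AbsRing) (V := C_NormedModule) F a.
Proof.
intros Ha. destruct k as [|p k]; simpl; [lia|]. intros Hk Hp HF.
destruct (dist_pos_ints a Ha) as [delta [c [Hd [Hc H]]]].
refine (tame_series_ex_derive a delta _ _ 3 F Hd
  (tame_star_sum_summand a delta c ltac:(lra) Hc H p k Hp Hk)
  rsum_inv_pow_three_halves_le _).
intros b Hb. apply HF. intros n Hn ->. specialize (H n _ Hn Hb).
replace (RtoC (INR n) - RtoC (INR n))%C with (RtoC 0) in H by ring.
rewrite Cmod_0 in H. pose proof (INR_ge_1 n Hn).
assert (0 < c * INR n) by (apply Rmult_lt_0_compat; lra). lra.
Qed.

(** * Multiple polylogarithms in the variable [x / (x - 1)] *)

Lemma RInt_0_is_derive (g : R -> R) : (forall t, t < 1 -> continuous g t) ->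
  forall z, z < 1 -> is_derive (fun z => RInt g 0 z) z (g z).
Proof.
intros H z Hz. apply (is_derive_RInt g) with 0; [|now apply H].
assert (P : 0 < 1 - z) by lra. exists (mkposreal _ P). intros y Hy.
change (Rabs (y - z) < 1 - z) in Hy. apply Rabs_lt_between in Hy.
apply (RInt_correct g). apply ex_RInt_continuous. intros x Hx. apply H.
assert (Rmax 0 y < 1) by (apply Rmax_lub_lt; lra). lra.
Qed.

(** The continuous extension of [f t / t] when [f 0 = 0]. *)
Definition slope0 (f : R -> R) (t : R) : R :=
  if Req_EM_T t 0 then Derive f 0 else f t / t.

Lemma slope0_neq_0 f t : t <> 0 -> slope0 f t = f t / t.
Proof. intros H. unfold slope0. now destruct (Req_EM_T t 0). Qed.

Lemma slope0_continuous (f : R -> R) t : f 0 = 0 -> ex_derive f 0 -> ex_derive f t ->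
  continuous (slope0 f) t.
Proof.
intros F0 D0 Dt. destruct (Req_EM_T t 0) as [->|N].
- apply continuity_pt_filterlim.
  (* As [f 0 = 0], the difference quotient of [f] at [0] is [f t / t], and continuity there is the
     definition of the derivative. *)
  apply Derive_correct, is_derive_Reals in D0. intros eps He.
  destruct (D0 eps He) as [delta Hd]. exists delta. split; [apply cond_pos|].
  intros x [[_ Hx] Hdx]. simpl in *. unfold R_dist in *.
  specialize (Hd x ltac:(congruence)).
  rewrite Rminus_0_r in Hdx. specialize (Hd Hdx).
  rewrite Rplus_0_l, F0, Rminus_0_r in Hd.
  rewrite slope0_neq_0 by congruence. unfold slope0.
  now destruct (Req_EM_T 0 0).
- apply continuous_ext_loc with (fun t => f t / t).
  + assert (P : 0 < Rabs t) by now apply Rabs_pos_lt.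
    exists (mkposreal _ P). intros y Hy. change (Rabs (y - t) < Rabs t) in Hy.
    rewrite slope0_neq_0; [reflexivity|]. intros ->.
    rewrite Rminus_0_l, Rabs_Ropp in Hy. lra.
  + apply (ex_derive_continuous (fun t => f t / t)). auto_derive. now split.
Qed.

Lemma Li_one k z : Li (1%nat :: k) z = RInt (fun t => Li k t / (1 - t)) 0 z.
Proof. reflexivity. Qed.

Lemma Li_SS j k z : Li (S (S j) :: k) z = RInt (fun t => Li (S j :: k) t / t) 0 z.
Proof. simpl. now rewrite Nat.sub_0_r. Qed.

Lemma Li_SS_slope0 j k z : Li (S (S j) :: k) z = RInt (slope0 (Li (S j :: k))) 0 z.
Proof.
rewrite Li_SS. apply RInt_ext. intros x Hx. symmetry. apply slope0_neq_0. intros ->.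
destruct (Rle_lt_dec 0 z); [rewrite Rmin_left in Hx|rewrite Rmax_left in Hx]; lra.
Qed.

(** The two claims go together: division by [t] has a removable singularity only because the shorter
    index already vanishes at [0]. *)
Lemma Li_ex_derive k : Forall (fun x => (1 <= x)%nat) k ->
  (forall t, t < 1 -> ex_derive (Li k) t) /\ (k <> [] -> Li k 0 = 0).
Proof.
revert k. refine (composition_ind (fun k => (forall t, t < 1 -> ex_derive (Li k) t) /\
  (k <> [] -> Li k 0 = 0)) _ _ _).
- split; [|easy]. intros t _. apply (ex_derive_const (K := R_AbsRing) (V := R_NormedModule)).
- intros k _ [IH _]. split.
  + intros t Ht. eexists.
    apply (RInt_0_is_derive (fun t => Li k t / (1 - t))); [|exact Ht].
    intros u Hu. apply (ex_derive_continuous (fun t => Li k t / (1 - t))).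
    auto_derive. split; [now apply IH|]. split; [lra|exact I].
  + intros _. rewrite Li_one. apply (RInt_point (V := R_CompleteNormedModule)).
- intros j k _ [IH IH0]. split.
  + intros t Ht. exists (slope0 (Li (S j :: k)) t).
    apply (is_derive_ext (fun z => RInt (slope0 (Li (S j :: k))) 0 z));
      [intros u; now rewrite Li_SS_slope0|].
    apply RInt_0_is_derive; [|exact Ht].
    intros u Hu. apply slope0_continuous; [now apply IH0|apply IH; lra|now apply IH].
  + intros _. rewrite Li_SS. apply (RInt_point (V := R_CompleteNormedModule)).
Qed.

Lemma Li_one_is_derive k z : Forall (fun x => (1 <= x)%nat) k -> z < 1 ->
  is_derive (Li (1%nat :: k)) z (Li k z / (1 - z)).
Proof.
intros Hk Hz. apply (RInt_0_is_derive (fun t => Li k t / (1 - t))); [|exact Hz].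
intros u Hu. apply (ex_derive_continuous (fun t => Li k t / (1 - t))).
auto_derive. split; [now apply Li_ex_derive|]. split; [lra|exact I].
Qed.

Lemma Li_SS_is_derive j k z : Forall (fun x => (1 <= x)%nat) k -> z < 1 -> z <> 0 ->
  is_derive (Li (S (S j) :: k)) z (Li (S j :: k) z / z).
Proof.
intros Hk Hz N.
assert (Hk' : Forall (fun x => (1 <= x)%nat) (S j :: k)) by (constructor; [lia|assumption]).
destruct (Li_ex_derive _ Hk') as [D D0].
apply (is_derive_ext (fun z => RInt (slope0 (Li (S j :: k))) 0 z));
  [intros u; now rewrite Li_SS_slope0|].
rewrite <- slope0_neq_0 by assumption.
apply RInt_0_is_derive; [|exact Hz].
intros u Hu. apply slope0_continuous; [now apply D0|apply D; lra|now apply D].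
Qed.

Definition LiM (k : list nat) (x : R) : R := Li k (x / (x - 1)).

Lemma mobius_lt_1 x : x < 1 -> x / (x - 1) < 1.
Proof.
intros H. replace (x / (x - 1)) with (1 - / (1 - x)) by (field; lra).
assert (0 < / (1 - x)) by (apply Rinv_0_lt_compat; lra). lra.
Qed.

Lemma mobius_is_derive x : x < 1 -> is_derive (fun x => x / (x - 1)) x (- / (1 - x) ^ 2).
Proof. intros H. auto_derive; [lra|]. field. lra. Qed.

Lemma LiM_is_derive k x l : x < 1 -> is_derive (Li k) (x / (x - 1)) l ->
  is_derive (LiM k) x (- / (1 - x) ^ 2 * l).
Proof.
intros Hx H. unfold LiM.
apply (is_derive_comp (Li k) (fun x => x / (x - 1))); [exact H|now apply mobius_is_derive].
Qed.

Lemma LiM_ex_derive k x : Forall (fun x => (1 <= x)%nat) k -> x < 1 -> ex_derive (LiM k) x.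
Proof.
intros Hk Hx. eexists. apply LiM_is_derive; [exact Hx|].
apply Derive_correct, Li_ex_derive; [exact Hk|now apply mobius_lt_1].
Qed.

Lemma LiM_0 k : Forall (fun x => (1 <= x)%nat) k -> k <> [] -> LiM k 0 = 0.
Proof.
intros Hk N. unfold LiM. replace (0 / (0 - 1)) with 0 by field. now apply Li_ex_derive.
Qed.

Lemma LiM_one_is_derive k x : Forall (fun x => (1 <= x)%nat) k -> x < 1 ->
  is_derive (LiM (1%nat :: k)) x (- (LiM k x / (1 - x))).
Proof.
intros Hk Hx.
replace (- (LiM k x / (1 - x)))
  with (- / (1 - x) ^ 2 * (Li k (x / (x - 1)) / (1 - x / (x - 1))))
  by (unfold LiM; field; lra).
apply LiM_is_derive, Li_one_is_derive; auto using mobius_lt_1.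
Qed.

Lemma LiM_SS_is_derive j k x : Forall (fun x => (1 <= x)%nat) k -> 0 < x < 1 ->
  is_derive (LiM (S (S j) :: k)) x (LiM (S j :: k) x / (x * (1 - x))).
Proof.
intros Hk Hx.
replace (LiM (S j :: k) x / (x * (1 - x)))
  with (- / (1 - x) ^ 2 * (Li (S j :: k) (x / (x - 1)) / (x / (x - 1))))
  by (unfold LiM; field; lra).
apply LiM_is_derive, Li_SS_is_derive; [lra|assumption|apply mobius_lt_1; lra|].
assert (x / (x - 1) < 0); [|lra].
replace (x / (x - 1)) with (- (x / (1 - x))) by (field; lra).
assert (0 < x / (1 - x)) by (apply Rdiv_lt_0_compat; lra). lra.
Qed.

(** * Growth of the polylogarithms as [x] tends to [1] *)

Lemma mean_value_le (f g f' g' : R -> R) b : 0 < b ->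
  (forall x, 0 < x < b -> is_derive f x (f' x)) ->
  (forall x, 0 < x < b -> is_derive g x (g' x)) ->
  (forall x, 0 <= x <= b -> continuous f x) ->
  (forall x, 0 <= x <= b -> continuous g x) ->
  (forall x, 0 < x < b -> Rabs (f' x) <= g' x) ->
  Rabs (f b - f 0) <= g b - g 0.
Proof.
intros Hb Df Dg Cf Cg H.
assert (M : forall s, s = 1 \/ s = -1 -> g 0 + s * f 0 <= g b + s * f b).
{ intros s Hs.
  (* The mean value point may be an endpoint, where nothing is assumed about [f'] and [g'].
     Truncation at [0] changes nothing inside the interval and secures the sign there. *)
  destruct (MVT_gen (fun x => g x + s * f x) 0 b (fun x => Rmax 0 (g' x + s * f' x)))
    as [c [_ Hc]].
  - intros x Hx. rewrite Rmin_left, Rmax_right in Hx by lra.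
    assert (P : 0 <= g' x + s * f' x).
    { specialize (H x Hx). apply Rabs_le_between in H. destruct Hs as [-> | ->]; lra. }
    rewrite Rmax_right by exact P.
    apply (is_derive_plus g (fun x => s * f x)); [now apply Dg|].
    apply (is_derive_scal f x s), Df, Hx.
  - intros x Hx. rewrite Rmin_left, Rmax_right in Hx by lra.
    apply continuity_pt_filterlim.
    apply (continuous_plus (V := R_NormedModule) g (fun x => s * f x)); [now apply Cg|].
    apply (continuous_scal_r (V := R_NormedModule) s f), Cf, Hx.
  - assert (0 <= Rmax 0 (g' c + s * f' c) * (b - 0)) by (apply Rmult_le_pos; [apply Rmax_l|lra]).
    lra. }
apply Rabs_le_between. pose proof (M 1 (or_introl eq_refl)).
pose proof (M (-1) (or_intror eq_refl)). lra.
Qed.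

(** [(1 - x)^tau] *)
Definition ypow (tau x : R) : R := exp (tau * ln (1 - x)).

Lemma ypow_pos tau x : 0 < ypow tau x.
Proof. apply exp_pos. Qed.

Lemma ypow_0 tau : ypow tau 0 = 1.
Proof. unfold ypow. rewrite Rminus_0_r, ln_1, Rmult_0_r. apply exp_0. Qed.

Lemma ypow_plus s t x : ypow (s + t) x = ypow s x * ypow t x.
Proof. unfold ypow. rewrite <- exp_plus. f_equal. ring. Qed.

Lemma ypow_1 x : x < 1 -> ypow 1 x = 1 - x.
Proof. intros H. unfold ypow. rewrite Rmult_1_l. apply exp_ln. lra. Qed.

Lemma ypow_le_1 tau x : 0 <= tau -> 0 <= x < 1 -> ypow tau x <= 1.
Proof.
intros Ht Hx. rewrite <- exp_0. unfold ypow.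
assert (ln (1 - x) <= 0) by (rewrite <- ln_1; apply ln_le; lra).
assert (E : tau * ln (1 - x) <= 0) by nra.
destruct E as [E|E]; [left; now apply exp_increasing|right; now rewrite E].
Qed.

Lemma ypow_is_derive tau x : x < 1 ->
  is_derive (ypow tau) x (- tau * ypow tau x / (1 - x)).
Proof. intros H. unfold ypow. auto_derive; [lra|]. unfold Rminus. field. lra. Qed.

(** Equivalent to (1-x)^(1-eps) <= 1. The factor [x] is retained to pay for a later division by
    [x]. *)
Lemma ypow_opp_minus_1_le eps x : 0 < eps <= 1 -> 0 <= x < 1 ->
  ypow (- eps) x - 1 <= x * ypow (- eps) x.
Proof.
intros He Hx. pose proof (ypow_le_1 (1 - eps) x ltac:(lra) Hx) as H.
replace (1 - eps) with (1 + - eps) in H by ring.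
rewrite ypow_plus, ypow_1 in H by lra. lra.
Qed.

Lemma ypow_opp_mult tau x : ypow (- tau) x * ypow tau x = 1.
Proof. rewrite <- ypow_plus, Rplus_opp_l. unfold ypow. rewrite Rmult_0_l. apply exp_0. Qed.

Lemma ypow_opp_ge_1 eps x : 0 <= eps -> 0 <= x < 1 -> 1 <= ypow (- eps) x.
Proof.
intros He Hx. pose proof (ypow_le_1 eps x He Hx).
pose proof (ypow_pos (- eps) x).
pose proof (ypow_opp_mult eps x). nra.
Qed.

(** Comparison with (C/eps)(1-x)^(-eps), whose derivative is the bound assumed on the derivative of
    [LiM k]. One integration costs a factor 1/eps and does not worsen the exponent. *)
Lemma LiM_bound_aux eps k C x : 0 < eps <= 1 -> 0 <= C -> 0 < x < 1 ->
  Forall (fun x => (1 <= x)%nat) k -> k <> [] ->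
  (forall y, 0 < y < 1 -> exists l, is_derive (LiM k) y l /\
     Rabs l <= C * ypow (- eps) y / (1 - y)) ->
  Rabs (LiM k x) <= C / eps * x * ypow (- eps) x.
Proof.
intros He HC Hx Hk N H.
assert (D : forall y, y < 1 -> is_derive (fun y => C / eps * ypow (- eps) y) y
   (C * ypow (- eps) y / (1 - y))).
{ intros y Hy.
  replace (C * ypow (- eps) y / (1 - y))
    with (C / eps * (- (- eps) * ypow (- eps) y / (1 - y))) by (field; lra).
  now apply (is_derive_scal (ypow (- eps))), ypow_is_derive. }
apply Rle_trans with (C / eps * ypow (- eps) x - C / eps * ypow (- eps) 0).
- replace (LiM k x) with (LiM k x - LiM k 0) by (rewrite LiM_0 by assumption; ring).
  apply (mean_value_le (LiM k) (fun y => C / eps * ypow (- eps) y) (Derive (LiM k))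
    (fun y => C * ypow (- eps) y / (1 - y))); [lra| | | | |].
  + intros y Hy. apply Derive_correct, LiM_ex_derive; [assumption|lra].
  + intros y Hy. apply D. lra.
  + intros y Hy. apply (ex_derive_continuous (LiM k)), LiM_ex_derive; [assumption|lra].
  + intros y Hy. apply (ex_derive_continuous (fun y => C / eps * ypow (- eps) y)).
    eexists. apply D. lra.
  + intros y Hy. destruct (H y ltac:(lra)) as [l [Hl B]].
    now rewrite (is_derive_unique _ _ _ Hl).
- rewrite ypow_0. pose proof (ypow_opp_minus_1_le eps x He ltac:(lra)).
  assert (0 <= C / eps) by (apply Rdiv_le_0_compat; lra). nra.
Qed.

(** The power (1-x)^(-eps) stands in for powers of the logarithm. The second bound, with its factor
    [x], is what the form [dx/(x(1-x))] consumes; it fails for the empty index, where [LiM] is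
    [1]. *)
Lemma LiM_bound eps k : 0 < eps <= 1 -> Forall (fun x => (1 <= x)%nat) k ->
  exists C, 0 <= C /\ forall x, 0 < x < 1 ->
    Rabs (LiM k x) <= C * ypow (- eps) x /\
    (k <> [] -> Rabs (LiM k x) <= C * x * ypow (- eps) x).
Proof.
intros He. revert k. refine (composition_ind (fun k => exists C, 0 <= C /\ forall x, 0 < x < 1 ->
    Rabs (LiM k x) <= C * ypow (- eps) x /\
    (k <> [] -> Rabs (LiM k x) <= C * x * ypow (- eps) x)) _ _ _).
- exists 1. split; [lra|]. intros x Hx. split; [|easy]. unfold LiM; simpl.
  rewrite Rabs_R1. pose proof (ypow_opp_ge_1 eps x). lra.
- intros k Hk [C [HC H]]. exists (C / eps).
  assert (HC' : 0 <= C / eps) by (apply Rdiv_le_0_compat; lra).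
  split; [assumption|]. intros x Hx.
  assert (B : Rabs (LiM (1%nat :: k) x) <= C / eps * x * ypow (- eps) x).
  { apply LiM_bound_aux; [exact He|exact HC|exact Hx|constructor; [lia|exact Hk]|easy|].
    intros y Hy. eexists. split; [apply LiM_one_is_derive; [assumption|lra]|].
    rewrite Rabs_Ropp. unfold Rdiv. rewrite Rabs_mult, (Rabs_pos_eq (/ _))
      by (apply Rlt_le, Rinv_0_lt_compat; lra).
    apply Rmult_le_compat_r; [apply Rlt_le, Rinv_0_lt_compat; lra|]. now apply H. }
  split; [|intros _; exact B]. eapply Rle_trans; [exact B|].
  apply Rmult_le_compat_r; [apply Rlt_le, ypow_pos|]. nra.
- intros j k Hk [C [HC H]]. exists (C / eps).
  assert (HC' : 0 <= C / eps) by (apply Rdiv_le_0_compat; lra).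
  split; [assumption|]. intros x Hx.
  assert (B : Rabs (LiM (S (S j) :: k) x) <= C / eps * x * ypow (- eps) x).
  { apply LiM_bound_aux; [exact He|exact HC|exact Hx|constructor; [lia|exact Hk]|easy|].
    intros y Hy. eexists. split; [now apply LiM_SS_is_derive|].
    destruct (H y Hy) as [_ H1]. specialize (H1 ltac:(easy)).
    assert (P : 0 < / (y * (1 - y))) by (apply Rinv_0_lt_compat; nra).
    unfold Rdiv at 1. rewrite Rabs_mult, (Rabs_pos_eq (/ _)) by lra.
    replace (C * ypow (- eps) y / (1 - y)) with (C * y * ypow (- eps) y * / (y * (1 - y)))
      by (field; lra).
    apply Rmult_le_compat_r; lra. }
  split; [|intros _; exact B]. eapply Rle_trans; [exact B|].
  apply Rmult_le_compat_r; [apply Rlt_le, ypow_pos|]. nra.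
Qed.

(** * Integration by parts against the kernels *)

Definition is_cderive (f : R -> C) (x : R) (l : C) : Prop :=
  is_derive (fun t => fst (f t)) x (fst l) /\ is_derive (fun t => snd (f t)) x (snd l).

Lemma is_cderive_plus f g x l m : is_cderive f x l -> is_cderive g x m ->
  is_cderive (fun t => f t + g t)%C x (l + m)%C.
Proof.
intros [F1 F2] [G1 G2]. split.
- now apply (is_derive_plus (fun t => fst (f t)) (fun t => fst (g t))).
- now apply (is_derive_plus (fun t => snd (f t)) (fun t => snd (g t))).
Qed.

Lemma is_cderive_ext f g x l : (forall t, f t = g t) -> is_cderive f x l -> is_cderive g x l.
Proof.
intros E [F1 F2]. split.
- now apply (is_derive_ext (fun t => fst (f t))); [intros t; rewrite E|].
- now apply (is_derive_ext (fun t => snd (f t))); [intros t; rewrite E|].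
Qed.

Lemma is_derive_value (f : R -> R) x l m : l = m -> is_derive f x l -> is_derive f x m.
Proof. now intros ->. Qed.

Lemma is_cderive_scal (g : R -> R) (f : R -> C) x (g' : R) l :
  is_derive g x g' -> is_cderive f x l ->
  is_cderive (fun t => RtoC (g t) * f t)%C x (RtoC g' * f x + RtoC (g x) * l)%C.
Proof.
intros G [F1 F2]. split.
- apply (is_derive_ext (fun t => g t * fst (f t))); [intros t; simpl; ring|].
  eapply is_derive_value; [|apply (is_derive_mult g (fun t => fst (f t)) x); [exact G|exact F1|]].
  + unfold plus, mult; simpl; ring.
  + intros n m. apply Rmult_comm.
- apply (is_derive_ext (fun t => g t * snd (f t))); [intros t; simpl; ring|].
  eapply is_derive_value; [|apply (is_derive_mult g (fun t => snd (f t)) x); [exact G|exact F2|]].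
  + unfold plus, mult; simpl; ring.
  + intros n m. apply Rmult_comm.
Qed.

Lemma is_cderive_cscal (c : C) f x l : is_cderive f x l ->
  is_cderive (fun t => c * f t)%C x (c * l)%C.
Proof.
intros [F1 F2]. split; simpl.
- apply (is_derive_minus (fun t => fst c * fst (f t)) (fun t => snd c * snd (f t)));
    now apply (is_derive_scal (fun t => _ (f t))).
- apply (is_derive_plus (fun t => fst c * snd (f t)) (fun t => snd c * fst (f t)));
    now apply (is_derive_scal (fun t => _ (f t))).
Qed.

Lemma is_cderive_csum (f : nat -> R -> C) (l : nat -> C) x N :
  (forall n, (1 <= n <= N)%nat -> is_cderive (f n) x (l n)) ->
  is_cderive (fun t => csum (fun n => f n t) N) x (csum l N).
Proof.
induction N as [|N IH]; intros H.
- apply is_cderive_ext with (fun _ => RtoC 0); [intros t; now rewrite csum_0|].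
  rewrite csum_0. split; apply (is_derive_const (V := R_NormedModule)).
- apply is_cderive_ext with (fun t => csum (fun n => f n t) N + f (S N) t)%C;
    [intros t; now rewrite csum_S|].
  rewrite csum_S. apply is_cderive_plus; [apply IH; intros; apply H|apply H]; lia.
Qed.

Definition ccontinuous (f : R -> C) (x : R) : Prop :=
  continuous (fun t => fst (f t)) x /\ continuous (fun t => snd (f t)) x.

Lemma is_cderive_ccontinuous f x l : is_cderive f x l -> ccontinuous f x.
Proof.
intros [H1 H2]. split.
- apply (ex_derive_continuous (fun t => fst (f t))). exists (fst l). exact H1.
- apply (ex_derive_continuous (fun t => snd (f t))). exists (snd l). exact H2.
Qed.

Lemma ccontinuous_plus f g x : ccontinuous f x -> ccontinuous g x ->
  ccontinuous (fun t => f t + g t)%C x.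
Proof.
intros [F1 F2] [G1 G2]. split.
- now apply (continuous_plus (V := R_NormedModule) (fun t => fst (f t)) (fun t => fst (g t))).
- now apply (continuous_plus (V := R_NormedModule) (fun t => snd (f t)) (fun t => snd (g t))).
Qed.

Lemma ccontinuous_opp f x : ccontinuous f x -> ccontinuous (fun t => - f t)%C x.
Proof.
intros [F1 F2]. split.
- now apply (continuous_opp (V := R_NormedModule) (fun t => fst (f t))).
- now apply (continuous_opp (V := R_NormedModule) (fun t => snd (f t))).
Qed.

(** Real and imaginary parts are treated separately; the factor 2 rounds up [sqrt 2]. *)
Lemma cmean_value_le (f f' : R -> C) (g g' : R -> R) b : 0 < b ->
  (forall x, 0 < x < b -> is_cderive f x (f' x)) ->
  (forall x, 0 < x < b -> is_derive g x (g' x)) ->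
  (forall x, 0 <= x <= b -> ccontinuous f x) ->
  (forall x, 0 <= x <= b -> continuous g x) ->
  (forall x, 0 < x < b -> Cmod (f' x) <= g' x) ->
  Cmod (f b - f 0) <= 2 * (g b - g 0).
Proof.
intros Hb Df Dg Cf Cg H.
assert (M : forall x, 0 < x < b -> Rabs (fst (f' x)) <= g' x /\ Rabs (snd (f' x)) <= g' x).
{ intros x Hx. specialize (H x Hx). pose proof (Rmax_Cmod (f' x)) as L.
  split; (eapply Rle_trans; [|exact H]); (eapply Rle_trans; [|exact L]);
    [apply Rmax_l|apply Rmax_r]. }
assert (B1 : Rabs (fst (f b) - fst (f 0)) <= g b - g 0).
{ apply (mean_value_le (fun t => fst (f t)) g (fun t => fst (f' t)) g'); auto;
    intros x Hx; [now apply Df|now apply Cf|now apply M]. }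
assert (B2 : Rabs (snd (f b) - snd (f 0)) <= g b - g 0).
{ apply (mean_value_le (fun t => snd (f t)) g (fun t => snd (f' t)) g'); auto;
    intros x Hx; [now apply Df|now apply Cf|now apply M]. }
eapply Rle_trans; [apply Cmod_2Rmax|]. simpl.
assert (S2 : sqrt 2 <= 2).
{ rewrite <- (sqrt_square 2) at 2 by lra. apply sqrt_le_1_alt. lra. }
apply Rmult_le_compat; [apply sqrt_pos| |exact S2|now apply Rmax_lub].
eapply Rle_trans; [apply Rabs_pos|apply Rmax_l].
Qed.

(** * Complex powers of a positive real *)

Lemma Cmod_Rcpow y alpha : Cmod (Rcpow y alpha) = exp (Re alpha * ln y).
Proof.
unfold Rcpow. rewrite Cmod_mult, Cmod_R, Rabs_pos_eq by apply Rlt_le, exp_pos.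
unfold Cmod; simpl. rewrite !Rmult_1_r.
pose proof (sin2_cos2 (Im alpha * ln y)) as E. unfold Rsqr in E.
rewrite Rplus_comm, E, sqrt_1. ring.
Qed.

Lemma Rcpow_opp y alpha : Rcpow y (- alpha) = (/ Rcpow y alpha)%C.
Proof.
assert (N : Rcpow y alpha <> RtoC 0).
{ apply Cmod_gt_0. rewrite Cmod_Rcpow. apply exp_pos. }
enough (E : (Rcpow y (- alpha) * Rcpow y alpha)%C = RtoC 1).
{ rewrite <- (Cmult_1_l (/ Rcpow y alpha)), <- E. field. exact N. }
unfold Rcpow. destruct alpha as [u v]. cbn -[exp ln cos sin].
replace (- u * ln y) with (- (u * ln y)) by ring.
replace (- v * ln y) with (- (v * ln y)) by ring.
rewrite cos_neg, sin_neg, exp_Ropp.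
pose proof (sin2_cos2 (v * ln y)) as E. unfold Rsqr in E.
pose proof (exp_pos (u * ln y)) as P.
set (s := sin (v * ln y)) in *. set (c := cos (v * ln y)) in *. set (e := exp (u * ln y)) in *.
unfold Cmult; simpl.
apply injective_projections; simpl; [|field; lra].
transitivity (s * s + c * c); [field; lra|exact E].
Qed.

Lemma Rcpow_opp_is_cderive alpha x : x < 1 ->
  is_cderive (fun x => Rcpow (1 - x) (- alpha)) x
    (alpha * Rcpow (1 - x) (- alpha) * RtoC (/ (1 - x)))%C.
Proof.
intros Hx. unfold Rcpow. destruct alpha as [u v]. split; cbn -[exp ln cos sin].
- auto_derive; [lra|]. unfold Rminus. field. lra.
- auto_derive; [lra|]. unfold Rminus. field. lra.
Qed.

Section MainEstimate.

Variables (alpha : C) (eps tau c0 : R).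
Hypothesis Heps : 0 < eps <= 1.
Hypothesis Htau : 0 < tau.
Hypothesis Halpha : Re alpha + eps + tau = 1.
Hypothesis Hc0 : 0 < c0.

Let d (n : nat) : C := (RtoC (INR n) - alpha)%C.
Hypothesis Hd : forall n, (1 <= n)%nat -> c0 * INR n <= Cmod (d n).

(** [(1 - x)^(n - alpha)] *)
Definition mono (n : nat) (x : R) : C := (RtoC ((1 - x) ^ n) * Rcpow (1 - x) (- alpha))%C.

Definition kern (Q : nat -> C) (N : nat) (x : R) : C := csum (fun n => Q n * mono (n - 1) x)%C N.

(** This is the integral of [kern Q N] from [x] to [1], so that integration by parts leaves no
    boundary term at [1]. *)
Definition prim (Q : nat -> C) (N : nat) (x : R) : C := csum (fun n => Q n / d n * mono n x)%C N.

Lemma d_neq_0 n : (1 <= n)%nat -> d n <> RtoC 0.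
Proof.
intros Hn. apply Cmod_gt_0. specialize (Hd n Hn). pose proof (INR_ge_1 n Hn).
assert (0 < c0 * INR n) by (apply Rmult_lt_0_compat; lra). lra.
Qed.

Lemma mono_S n x : mono (S n) x = (RtoC (1 - x) * mono n x)%C.
Proof. unfold mono. simpl. rewrite RtoC_mult. ring. Qed.

Lemma mono_0 n : mono n 0 = RtoC 1.
Proof.
unfold mono, Rcpow. rewrite Rminus_0_r, pow1, ln_1, !Rmult_0_r, exp_0, cos_0, sin_0.
apply injective_projections; simpl; ring.
Qed.

Lemma mono_is_cderive n x : x < 1 ->
  is_cderive (mono (S n)) x (- d (S n) * mono n x)%C.
Proof.
intros Hx.
assert (E : (- d (S n) * mono n x)%C =
  (RtoC (- INR (S n) * (1 - x) ^ n) * Rcpow (1 - x) (- alpha) +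
   RtoC ((1 - x) ^ S n) * (alpha * Rcpow (1 - x) (- alpha) * RtoC (/ (1 - x))))%C).
{ unfold d, mono. rewrite <- tech_pow_Rmult, !RtoC_mult, RtoC_opp, RtoC_inv by lra.
  field. intros A. apply RtoC_inj in A. lra. }
rewrite E. apply (is_cderive_scal (fun x => (1 - x) ^ S n)); [|now apply Rcpow_opp_is_cderive].
auto_derive; [exact I|]. change (- (1) * (INR (S n) * (1 + - x) ^ n) = - INR (S n) * (1 + - x) ^ n). ring.
Qed.

Lemma prim_is_cderive Q N x : x < 1 -> is_cderive (prim Q N) x (- kern Q N x)%C.
Proof.
intros Hx. unfold prim, kern.
replace (- csum (fun n => Q n * mono (n - 1) x) N)%C
  with (csum (fun n => Q n / d n * (- d n * mono (n - 1) x)) N)%C.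
- apply (is_cderive_csum (fun n x => Q n / d n * mono n x)%C). intros n Hn.
  apply is_cderive_cscal. destruct n as [|n]; [lia|].
  replace (S n - 1)%nat with n by lia. now apply mono_is_cderive.
- replace (- csum (fun n => Q n * mono (n - 1) x)%C N)%C
    with (RtoC (-1) * csum (fun n => Q n * mono (n - 1) x)%C N)%C by ring.
  rewrite <- csum_scal. apply csum_ext. intros n Hn. field. apply d_neq_0. lia.
Qed.

(** The factor [1 - x] cancels the denominator shared by [dx/(1-x)] and [dx/(x(1-x))]. *)
Lemma prim_kern Q N x : prim Q N x = (RtoC (1 - x) * kern (fun n => Q n / d n) N x)%C.
Proof.
unfold prim, kern. rewrite <- csum_scal. apply csum_ext. intros n Hn.
destruct n as [|n]; [lia|]. replace (S n - 1)%nat with n by lia. rewrite mono_S. ring.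
Qed.

(** Abel summation: dividing by [x] replaces [Q] by its partial sums, up to the last term. *)
Lemma kern_summation Q N x :
  kern Q N x = (RtoC x * kern (csum Q) N x + csum Q N * mono N x)%C.
Proof.
induction N as [|N IH]; unfold kern in *; [rewrite !csum_0; ring|].
rewrite !csum_S, IH. replace (S N - 1)%nat with N by lia.
rewrite mono_S, RtoC_minus. ring.
Qed.

Lemma prim_0 Q N : prim Q N 0 = csum (fun n => Q n / d n)%C N.
Proof. apply csum_ext. intros n _. rewrite mono_0. ring. Qed.

(** One factor [1 - x] is spent to turn the exponent [- Re alpha] into the positive [tau + eps]. *)
Lemma Cmod_mono_le n x : 0 < x < 1 ->
  Cmod (mono (S n) x) = (1 - x) ^ n * (ypow tau x * ypow eps x).
Proof.
intros Hx. unfold mono. rewrite Cmod_mult, Cmod_R, Cmod_Rcpow.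
rewrite Rabs_pos_eq by (apply pow_le; lra).
rewrite <- ypow_plus. replace (tau + eps) with (1 + Re (- alpha)).
- rewrite ypow_plus, ypow_1 by lra. unfold ypow. simpl. ring.
- change (Re (- alpha)) with (- Re alpha). lra.
Qed.

Lemma prim_bound Q N : exists M, 0 <= M /\
  forall x, 0 < x < 1 -> Cmod (prim Q N x) <= M * (ypow tau x * ypow eps x).
Proof.
exists (rsum (fun n => Cmod (Q n / d n)%C) N). split.
- replace 0 with (rsum (fun _ => 0) N).
  + apply rsum_le. intros; apply Cmod_ge_0.
  + clear. induction N as [|N IH]; [now rewrite rsum_0|rewrite rsum_S, IH; ring].
- intros x Hx. unfold prim. rewrite Rmult_comm, <- rsum_scal.
  apply Cmod_csum_le. intros n Hn. destruct n as [|n]; [lia|].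
  rewrite Cmod_mult, Cmod_mono_le by assumption.
  rewrite Rmult_comm. apply Rmult_le_compat_r; [apply Cmod_ge_0|].
  rewrite <- (Rmult_1_l (ypow tau x * _)) at 2.
  apply Rmult_le_compat_r; [apply Rmult_le_pos; apply Rlt_le, ypow_pos|].
  apply Rle_trans with (1 ^ n); [apply pow_incr|rewrite pow1]; lra.
Qed.

(** The gap [1 - Re alpha] is split in two: [eps] absorbs the growth of [LiM k], and [tau] makes the
    boundary term vanish at [1]. [M] may depend on [N], since [x] tends to [1] with [N] fixed. *)
Lemma LiM_prim_bound k Q N : Forall (fun x => (1 <= x)%nat) k -> exists M, 0 <= M /\
  forall x, 0 < x < 1 -> Cmod (RtoC (LiM k x) * prim Q N x) <= M * ypow tau x.
Proof.
intros Hk. destruct (LiM_bound eps k Heps Hk) as [G [HG B]].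
destruct (prim_bound Q N) as [M [HM P]].
exists (G * M). split; [now apply Rmult_le_pos|].
intros x Hx. rewrite Cmod_mult, Cmod_R. destruct (B x Hx) as [B1 _]. specialize (P x Hx).
apply Rle_trans with (G * ypow (- eps) x * (M * (ypow tau x * ypow eps x))).
- apply Rmult_le_compat; auto using Rabs_pos, Cmod_ge_0.
- right.
  transitivity (G * M * ypow tau x * (ypow (- eps) x * ypow eps x)); [ring|].
  rewrite ypow_opp_mult. ring.
Qed.

Lemma LiM_prim_is_cderive k Q N x l : x < 1 -> is_derive (LiM k) x l ->
  is_cderive (fun x => RtoC (LiM k x) * prim Q N x)%C x
    (RtoC l * prim Q N x + RtoC (LiM k x) * - kern Q N x)%C.
Proof. intros Hx H. apply is_cderive_scal; [exact H|now apply prim_is_cderive]. Qed.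

Lemma LiM_prim_ccontinuous k Q N x : Forall (fun x => (1 <= x)%nat) k -> x < 1 ->
  ccontinuous (fun x => RtoC (LiM k x) * prim Q N x)%C x.
Proof.
intros Hk Hx. eapply is_cderive_ccontinuous, LiM_prim_is_cderive; [exact Hx|].
now apply Derive_correct, LiM_ex_derive.
Qed.

(** The zero of [LiM k] at [0] pays for the division by [x], and [eps] for the growth at [1]. Here
    the constant must not depend on [N]: the remaining power integrates to 1/N. *)
Lemma LiM_mono_bound k : Forall (fun x => (1 <= x)%nat) k -> k <> [] ->
  exists G, 0 <= G /\ forall N x, (1 <= N)%nat -> 0 < x < 1 ->
    Cmod (RtoC (LiM k x / x) * mono N x) <= G * (1 - x) ^ (N - 1).
Proof.
intros Hk Nk. destruct (LiM_bound eps k Heps Hk) as [G [HG BG]].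
exists G. split; [exact HG|]. intros N x HN Hx.
destruct (BG x Hx) as [_ BG']. specialize (BG' Nk). destruct N as [|N]; [lia|].
rewrite Cmod_mult, Cmod_R, Cmod_mono_le by assumption.
replace (S N - 1)%nat with N by lia.
assert (L : Rabs (LiM k x / x) <= G * ypow (- eps) x).
{ unfold Rdiv. rewrite Rabs_mult, (Rabs_pos_eq (/ x))
    by (apply Rlt_le, Rinv_0_lt_compat; lra).
  apply (Rle_div_l _ _ x); [lra|]. lra. }
assert (P : 0 <= (1 - x) ^ N) by (apply pow_le; lra).
assert (T : ypow tau x <= 1) by (apply ypow_le_1; lra).
apply Rle_trans with (G * ypow (- eps) x * ((1 - x) ^ N * (1 * ypow eps x))).
- apply Rmult_le_compat; [apply Rabs_pos| |exact L|].
  + apply Rmult_le_pos; [exact P|]. apply Rmult_le_pos; apply Rlt_le, ypow_pos.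
  + apply Rmult_le_compat_l; [exact P|]. apply Rmult_le_compat_r; [apply Rlt_le, ypow_pos|exact T].
- right. transitivity (G * (1 - x) ^ N * (ypow (- eps) x * ypow eps x)); [ring|].
  rewrite ypow_opp_mult. ring.
Qed.

Lemma Cmod_div_d_le (Q : nat -> C) B n : 0 <= B -> (1 <= n)%nat ->
  Cmod (Q n) <= B * sqrt (INR n) -> Cmod (Q n / d n) <= B / c0 * / sqrt (INR n).
Proof.
intros HB Hn H. pose proof (INR_ge_1 n Hn) as P. pose proof (sqrt_INR_ge_1 n Hn) as S.
pose proof (Hd n Hn) as D.
assert (P' : 0 < c0 * INR n) by (apply Rmult_lt_0_compat; lra).
unfold Cdiv. rewrite Cmod_mult, Cmod_inv by now apply d_neq_0.
apply Rle_trans with (B * sqrt (INR n) * / (c0 * INR n)).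
- apply Rmult_le_compat; [apply Cmod_ge_0| |exact H|now apply Rinv_le_contravar].
  apply Rlt_le, Rinv_0_lt_compat. lra.
- right. rewrite <- (sqrt_sqrt (INR n)) at 2 by lra. field. lra.
Qed.

(** [E] is a primitive of [LiM k * kern Q N] up to the error [e], which contributes
    [O(N^(-1/2))].  In the induction step [E + LiM k * prim Q N], up to sign, is such a
    primitive for the shorter index. *)
Lemma LiM_kern_integral_estimate k : Forall (fun x => (1 <= x)%nat) k ->
  forall (Q : nat -> C) (A B : R), 0 <= A -> 0 <= B ->
  (forall n, (1 <= n)%nat -> Cmod (Q n) <= B * sqrt (INR n)) ->
  exists D, forall N, (1 <= N)%nat -> forall E e : R -> C,
    (forall x, 0 < x < 1 -> is_cderive E x (RtoC (LiM k x) * kern Q N x + e x)%C) ->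
    ccontinuous E 0 -> E 0 = RtoC 0 ->
    (forall x, 0 < x < 1 -> Cmod (e x) <= A * sqrt (INR N) * (1 - x) ^ (N - 1)) ->
    exists M, forall b, 0 < b < 1 ->
      Cmod (E b - (- RtoC 1) ^ length k * star_sum d Q (rev_dual_plus k) N)%C
        <= D / sqrt (INR N) + M * ypow tau b.
Proof.
revert k. refine (composition_ind (fun k =>
  forall (Q : nat -> C) (A B : R), 0 <= A -> 0 <= B ->
  (forall n, (1 <= n)%nat -> Cmod (Q n) <= B * sqrt (INR n)) ->
  exists D, forall N, (1 <= N)%nat -> forall E e : R -> C,
    (forall x, 0 < x < 1 -> is_cderive E x (RtoC (LiM k x) * kern Q N x + e x)%C) ->
    ccontinuous E 0 -> E 0 = RtoC 0 ->
    (forall x, 0 < x < 1 -> Cmod (e x) <= A * sqrt (INR N) * (1 - x) ^ (N - 1)) ->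
    exists M, forall b, 0 < b < 1 ->
      Cmod (E b - (- RtoC 1) ^ length k * star_sum d Q (rev_dual_plus k) N)%C
        <= D / sqrt (INR N) + M * ypow tau b) _ _ _).
(* As [LiM [] = 1], the function [E + prim Q N] has derivative [e], and its value at [0] is the sum
   sought. The integral of the error bound is at most A/sqrt(N), doubled by the complex mean value
   inequality. *)
- intros Q A B HA HB HQ. exists (2 * A). intros N HN E e HE CE E0 He.
  destruct (LiM_prim_bound [] Q N (Forall_nil _)) as [M [HM BM]].
  exists M. intros b Hb.
  assert (D : forall x, 0 < x < 1 ->
    is_cderive (fun x => E x + RtoC (LiM [] x) * prim Q N x)%C x (e x)).
  { intros x Hx. replace (e x) with ((RtoC (LiM [] x) * kern Q N x + e x)
      + (RtoC 0 * prim Q N x + RtoC (LiM [] x) * - kern Q N x))%C by ring.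
    apply is_cderive_plus; [now apply HE|]. apply LiM_prim_is_cderive; [lra|].
    apply (is_derive_const (V := R_NormedModule)). }
  pose proof (INR_ge_1 N HN) as PN. pose proof (sqrt_INR_ge_1 N HN) as SN.
  assert (DG : forall x, is_derive (fun x => - (A * sqrt (INR N) / INR N * (1 - x) ^ N)) x
     (A * sqrt (INR N) * (1 - x) ^ (N - 1))).
  { intros x. auto_derive; [exact I|]. replace (pred N) with (N - 1)%nat by lia.
    unfold Rminus. field. lra. }
  pose proof (cmean_value_le (fun x => E x + RtoC (LiM [] x) * prim Q N x)%C e
    (fun x => - (A * sqrt (INR N) / INR N * (1 - x) ^ N))
    (fun x => A * sqrt (INR N) * (1 - x) ^ (N - 1)) b ltac:(lra)) as MV.
  cbv beta in MV.
  assert (MV' : Cmod (E b + RtoC (LiM [] b) * prim Q N b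
     - (E 0 + RtoC (LiM [] 0) * prim Q N 0)) <= 2 * A / sqrt (INR N)).
  { eapply Rle_trans; [apply MV|].
    - intros x Hx. apply D. lra.
    - intros x Hx. apply DG.
    - intros x Hx. destruct (Req_dec x 0) as [->|N0].
      + apply ccontinuous_plus; [exact CE|]. apply LiM_prim_ccontinuous; [constructor|lra].
      + eapply is_cderive_ccontinuous, D. lra.
    - intros x Hx.
      apply (ex_derive_continuous (fun x => - (A * sqrt (INR N) / INR N * (1 - x) ^ N))).
      eexists. apply DG.
    - intros x Hx. apply He. lra.
    - rewrite Rminus_0_r, pow1.
      replace (2 * A / sqrt (INR N)) with (2 * (A * sqrt (INR N) / INR N)).
      + assert (P : 0 <= A * sqrt (INR N) / INR N * (1 - b) ^ N).
        { apply Rmult_le_pos; [|apply pow_le; lra].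
          apply Rdiv_le_0_compat; [apply Rmult_le_pos|]; lra. }
        lra.
      + rewrite <- (sqrt_sqrt (INR N)) at 2 by lra. field. lra. }
  rewrite E0, prim_0 in MV'.
  replace (star_sum d Q (rev_dual_plus []) N) with (csum (fun n => Q n / d n) N)%C
    by (simpl; apply csum_ext; intros n _; now rewrite Cmult_1_r).
  replace (E b - (- RtoC 1) ^ length (@nil nat) * csum (fun n => Q n / d n) N)%C
    with ((E b + RtoC (LiM [] b) * prim Q N b
     - (RtoC 0 + RtoC (LiM [] 0) * csum (fun n => Q n / d n) N))
     + - (RtoC (LiM [] b) * prim Q N b))%C
    by (unfold LiM; simpl; ring).
  eapply Rle_trans; [apply Cmod_triangle|]. rewrite Cmod_opp.
  apply Rplus_le_compat; [exact MV'|now apply BM].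
- intros k Hk IH Q A B HA HB HQ.
  assert (Hk' : Forall (fun x => (1 <= x)%nat) (1%nat :: k)) by (constructor; [lia|exact Hk]).
  assert (HB' : 0 <= B / c0) by (apply Rdiv_le_0_compat; lra).
  destruct (IH (fun n => Q n / d n)%C A (B / c0) HA HB') as [D HD].
  { intros n Hn. eapply Rle_trans; [exact (Cmod_div_d_le Q B n HB Hn (HQ n Hn))|].
    apply Rmult_le_compat_l; [exact HB'|].
    pose proof (sqrt_INR_ge_1 n Hn). apply Rle_trans with 1; [|lra].
    rewrite <- Rinv_1. apply Rinv_le_contravar; lra. }
  exists D. intros N HN E e HE CE E0 He.
  destruct (LiM_prim_bound (1%nat :: k) Q N Hk') as [M [HM BM]].
  (* By parts, the product with the kernel becomes minus [LiM k] times the kernel of [Q n / d n].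
     The outer negation restores the shape of the induction hypothesis and supplies one factor -1 of
     the final sign. *)
  destruct (HD N HN (fun x => - (E x + RtoC (LiM (1%nat :: k) x) * prim Q N x))%C
    (fun x => - e x)%C) as [M' HM'].
  + intros x Hx.
    assert (K : (RtoC (LiM k x) * kern (fun n => Q n / d n) N x + - e x)%C =
      (RtoC (-1) * ((RtoC (LiM (1%nat :: k) x) * kern Q N x + e x)
       + (RtoC (- (LiM k x / (1 - x))) * prim Q N x
          + RtoC (LiM (1%nat :: k) x) * - kern Q N x)))%C).
    { rewrite (prim_kern Q N x).
      rewrite RtoC_opp, RtoC_div by lra. field.
      intros Z. apply RtoC_inj in Z. lra. }
    rewrite K.
    apply is_cderive_ext with
      (fun x => RtoC (-1) * (E x + RtoC (LiM (1%nat :: k) x) * prim Q N x))%C;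
      [intros t; ring|].
    apply is_cderive_cscal, is_cderive_plus; [now apply HE|].
    apply LiM_prim_is_cderive; [lra|]. apply LiM_one_is_derive; [exact Hk|lra].
  + apply ccontinuous_opp, ccontinuous_plus; [exact CE|].
    apply LiM_prim_ccontinuous; [exact Hk'|lra].
  + rewrite E0, LiM_0 by easy. ring.
  + intros x Hx. rewrite Cmod_opp. now apply He.
  + exists (M' + M). intros b Hb.
    rewrite rev_dual_plus_one, star_sum_inc_last;
      [|exact d_neq_0|destruct k; [easy|rewrite rev_dual_plus_comp_plus by easy]].
    * set (Z := star_sum d (fun n => Q n / d n)%C (rev_dual_plus k) N).
      replace (E b - (- RtoC 1) ^ length (1%nat :: k) * Z)%C
        with (- (- (E b + RtoC (LiM (1%nat :: k) b) * prim Q N b) - (- RtoC 1) ^ length k * Z)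
          + - (RtoC (LiM (1%nat :: k) b) * prim Q N b))%C
        by (simpl; ring).
      eapply Rle_trans; [apply Cmod_triangle|]. rewrite !Cmod_opp.
      specialize (HM' b Hb). specialize (BM b Hb). cbv beta in HM'. fold Z in HM'. lra.
    * intros Z. destruct (rev_dual (n :: k)) eqn:Z'; [|easy].
      now apply (rev_dual_neq_nil (n :: k)).
- intros j k Hk IH Q A B HA HB HQ.
  assert (Hk' : Forall (fun x => (1 <= x)%nat) (S (S j) :: k)) by (constructor; [lia|exact Hk]).
  assert (Hk1 : Forall (fun x => (1 <= x)%nat) (S j :: k)) by (constructor; [lia|exact Hk]).
  assert (HB' : 0 <= B / c0) by (apply Rdiv_le_0_compat; lra).
  destruct (LiM_mono_bound (S j :: k) Hk1 ltac:(easy)) as [G [HG BG]].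
  set (Q' := csum (fun n => Q n / d n)%C).
  assert (HQ' : forall n, (1 <= n)%nat -> Cmod (Q' n) <= 2 * (B / c0) * sqrt (INR n)).
  { intros n Hn. apply Rle_trans with (rsum (fun n => B / c0 * / sqrt (INR n)) n).
    - apply Cmod_csum_le. intros m [Hm _]. exact (Cmod_div_d_le Q B m HB Hm (HQ m Hm)).
    - rewrite rsum_scal. rewrite (Rmult_comm 2), Rmult_assoc.
      apply Rmult_le_compat_l; [exact HB'|apply rsum_inv_sqrt_le]. }
  (* Abel summation adds to the error the term [LiM (S j :: k) x / x * Q' N * mono N x]: [Q' N] is
     at most 2(B/c0) sqrt(N), and the rest at most G (1-x)^(N-1). *)
  destruct (IH Q' (A + G * (2 * (B / c0))) (2 * (B / c0))) as [D HD];
    [|lra|exact HQ'|].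
  { apply Rplus_le_le_0_compat; [exact HA|apply Rmult_le_pos; lra]. }
  exists D. intros N HN E e HE CE E0 He.
  destruct (LiM_prim_bound (S (S j) :: k) Q N Hk') as [M [HM BM]].
  destruct (HD N HN (fun x => E x + RtoC (LiM (S (S j) :: k) x) * prim Q N x)%C
    (fun x => e x + RtoC (LiM (S j :: k) x / x) * (Q' N * mono N x))%C) as [M' HM'].
  + intros x Hx.
    assert (K : (RtoC (LiM (S j :: k) x) * kern Q' N x
        + (e x + RtoC (LiM (S j :: k) x / x) * (Q' N * mono N x)))%C =
      ((RtoC (LiM (S (S j) :: k) x) * kern Q N x + e x)
       + (RtoC (LiM (S j :: k) x / (x * (1 - x))) * prim Q N x
          + RtoC (LiM (S (S j) :: k) x) * - kern Q N x))%C).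
    { rewrite (prim_kern Q N x), (kern_summation (fun n => Q n / d n)%C). fold Q'.
      rewrite !RtoC_div, RtoC_mult by nra. field.
      split; intros Z; apply RtoC_inj in Z; lra. }
    rewrite K. apply is_cderive_plus; [now apply HE|].
    apply LiM_prim_is_cderive; [lra|]. now apply LiM_SS_is_derive.
  + apply ccontinuous_plus; [exact CE|]. apply LiM_prim_ccontinuous; [exact Hk'|lra].
  + rewrite E0, LiM_0 by easy. ring.
  + intros x Hx. eapply Rle_trans; [apply Cmod_triangle|].
    rewrite !Rmult_plus_distr_r. apply Rplus_le_compat; [now apply He|].
    replace (RtoC (LiM (S j :: k) x / x) * (Q' N * mono N x))%C
      with (Q' N * (RtoC (LiM (S j :: k) x / x) * mono N x))%C by ring.
    rewrite Cmod_mult.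
    replace (G * (2 * (B / c0)) * sqrt (INR N) * (1 - x) ^ (N - 1))
      with (2 * (B / c0) * sqrt (INR N) * (G * (1 - x) ^ (N - 1))) by ring.
    apply Rmult_le_compat; try apply Cmod_ge_0; [now apply HQ'|now apply BG].
  + exists (M' + M). intros b Hb.
    rewrite rev_dual_plus_SS, star_sum_snoc_one. fold Q'.
    change (length (S (S j) :: k)) with (length (S j :: k)).
    set (Z := ((- RtoC 1) ^ length (S j :: k) * star_sum d Q' (rev_dual_plus (S j :: k)) N)%C) in *.
    replace (E b - Z)%C with ((E b + RtoC (LiM (S (S j) :: k) b) * prim Q N b - Z)
      + - (RtoC (LiM (S (S j) :: k) b) * prim Q N b))%C by ring.
    eapply Rle_trans; [apply Cmod_triangle|]. rewrite Cmod_opp.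
    specialize (HM' b Hb). specialize (BM b Hb). cbv beta in HM'. fold Z in HM'. lra.
Qed.

End MainEstimate.

(** * The integral *)

Lemma integrand_factor k alpha x : 0 < x < 1 ->
  integrand k alpha x = (RtoC (LiM k x / x) * Rcpow (1 - x) (- alpha))%C.
Proof.
intros Hx. unfold integrand, LiM. rewrite Rcpow_opp, RtoC_div by lra. field. split.
- apply Cmod_gt_0. rewrite Cmod_Rcpow. apply exp_pos.
- intros E. apply RtoC_inj in E. lra.
Qed.

(** With [slope0] the integral can start at [0] itself, since [LiM k] vanishes there for nonempty
    [k]; only the endpoint [1] stays improper. *)
Definition primitive (k : list nat) (alpha : C) (x : R) : C :=
  (RInt (fun t => slope0 (LiM k) t * fst (Rcpow (1 - t) (- alpha))) 0 x,
   RInt (fun t => slope0 (LiM k) t * snd (Rcpow (1 - t) (- alpha))) 0 x).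

Section Primitive.

Variables (k : list nat) (alpha : C).
Hypothesis Hk : Forall (fun x => (1 <= x)%nat) k.
Hypothesis Nk : k <> [].

Lemma slope0_LiM_continuous t : t < 1 -> continuous (slope0 (LiM k)) t.
Proof.
intros Ht. apply slope0_continuous; [now apply LiM_0| |]; apply LiM_ex_derive; auto; lra.
Qed.

Lemma primitive_continuous_fst t : t < 1 ->
  continuous (fun t => slope0 (LiM k) t * fst (Rcpow (1 - t) (- alpha))) t.
Proof.
intros Ht. apply (continuous_mult (K := R_AbsRing)); [now apply slope0_LiM_continuous|].
apply (is_cderive_ccontinuous (fun t => Rcpow (1 - t) (- alpha)) t _
  (Rcpow_opp_is_cderive alpha t Ht)).
Qed.

Lemma primitive_continuous_snd t : t < 1 ->
  continuous (fun t => slope0 (LiM k) t * snd (Rcpow (1 - t) (- alpha))) t.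
Proof.
intros Ht. apply (continuous_mult (K := R_AbsRing)); [now apply slope0_LiM_continuous|].
apply (is_cderive_ccontinuous (fun t => Rcpow (1 - t) (- alpha)) t _
  (Rcpow_opp_is_cderive alpha t Ht)).
Qed.

Lemma primitive_is_cderive x : x < 1 ->
  is_cderive (primitive k alpha) x (RtoC (slope0 (LiM k) x) * Rcpow (1 - x) (- alpha))%C.
Proof.
intros Hx. split.
- eapply is_derive_value; [|apply (RInt_0_is_derive _ primitive_continuous_fst x Hx)].
  simpl; ring.
- eapply is_derive_value; [|apply (RInt_0_is_derive _ primitive_continuous_snd x Hx)].
  simpl; ring.
Qed.

Lemma primitive_0 : primitive k alpha 0 = RtoC 0.
Proof. unfold primitive. now rewrite !(RInt_point (V := R_CompleteNormedModule)). Qed.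

Lemma integrand_is_RInt p q : 0 < p < 1 -> 0 < q < 1 ->
  is_RInt (V := C_R_NormedModule) (integrand k alpha) p q
    (primitive k alpha q - primitive k alpha p)%C.
Proof.
intros Hp Hq.
assert (P : forall x, Rmin p q <= x <= Rmax p q -> 0 < x < 1).
{ intros x Hx. assert (0 < Rmin p q) by (apply Rmin_pos; lra).
  assert (Rmax p q < 1) by (apply Rmax_lub_lt; lra). lra. }
apply (is_RInt_fct_extend_pair (U := R_NormedModule) (V := R_NormedModule)).
- apply (is_RInt_ext (fun t => slope0 (LiM k) t * fst (Rcpow (1 - t) (- alpha)))).
  + intros x Hx. specialize (P x ltac:(lra)).
    rewrite integrand_factor, slope0_neq_0 by lra. simpl. ring.
  + apply (is_RInt_derive (V := R_CompleteNormedModule)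
      (fun x => RInt (fun t => slope0 (LiM k) t * fst (Rcpow (1 - t) (- alpha))) 0 x)).
    * intros x Hx. specialize (P x Hx).
      apply (RInt_0_is_derive _ primitive_continuous_fst x). lra.
    * intros x Hx. specialize (P x Hx). apply primitive_continuous_fst. lra.
- apply (is_RInt_ext (fun t => slope0 (LiM k) t * snd (Rcpow (1 - t) (- alpha)))).
  + intros x Hx. specialize (P x ltac:(lra)).
    rewrite integrand_factor, slope0_neq_0 by lra. simpl. ring.
  + apply (is_RInt_derive (V := R_CompleteNormedModule)
      (fun x => RInt (fun t => slope0 (LiM k) t * snd (Rcpow (1 - t) (- alpha))) 0 x)).
    * intros x Hx. specialize (P x Hx).
      apply (RInt_0_is_derive _ primitive_continuous_snd x). lra.
    * intros x Hx. specialize (P x Hx). apply primitive_continuous_snd. lra.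
Qed.

Lemma integrand_is_int01 (l : C) :
  (forall e, 0 < e -> exists delta, 0 < delta /\
     forall b, 0 < b < 1 -> 1 - b < delta -> Cmod (primitive k alpha b - l) < e) ->
  is_int01 (integrand k alpha) l.
Proof.
intros H P [e HP].
destruct (is_cderive_ccontinuous _ _ _ (primitive_is_cderive 0 ltac:(lra))) as [C1 C2].
assert (He : 0 < e / 2) by apply (is_pos_div_2 e).
apply (filterlim_locally (U := R_UniformSpace)) with (eps := mkposreal _ He) in C1.
apply (filterlim_locally (U := R_UniformSpace)) with (eps := mkposreal _ He) in C2.
destruct (filter_and _ _ C1 C2) as [d0 H0].
destruct (H (e / 2) He) as [d1 [Hd1 H1]].
apply (Filter_prod _ _ _
  (fun a => 0 < a < 1 /\ Rabs (fst (primitive k alpha a)) < e / 2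
                      /\ Rabs (snd (primitive k alpha a)) < e / 2)
  (fun b => 0 < b < 1 /\ Cmod (primitive k alpha b - l) < e / 2)).
- exists (mkposreal (Rmin d0 1) (Rmin_pos _ _ (cond_pos d0) Rlt_0_1)).
  intros a Ha Pa. change (Rabs (a - 0) < Rmin d0 1) in Ha.
  assert (A1 : Rabs (a - 0) < d0) by (eapply Rlt_le_trans; [exact Ha|apply Rmin_l]).
  assert (A2 : Rabs (a - 0) < 1) by (eapply Rlt_le_trans; [exact Ha|apply Rmin_r]).
  split; [rewrite Rminus_0_r, Rabs_pos_eq in A2; lra|].
  destruct (H0 a A1) as [B1 B2].
  change (Rabs (fst (primitive k alpha a) - fst (primitive k alpha 0)) < e / 2) in B1.
  change (Rabs (snd (primitive k alpha a) - snd (primitive k alpha 0)) < e / 2) in B2.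
  rewrite primitive_0 in B1, B2. simpl in B1, B2. now rewrite Rminus_0_r in B1, B2.
- exists (mkposreal (Rmin d1 1) (Rmin_pos _ _ Hd1 Rlt_0_1)).
  intros b Hb Pb. change (Rabs (b - 1) < Rmin d1 1) in Hb.
  assert (A1 : Rabs (b - 1) < d1) by (eapply Rlt_le_trans; [exact Hb|apply Rmin_l]).
  assert (A2 : Rabs (b - 1) < 1) by (eapply Rlt_le_trans; [exact Hb|apply Rmin_r]).
  rewrite Rabs_left in A1, A2 by lra. split; [lra|]. apply H1; lra.
- intros a b [Ha [A1 A2]] [Hb B]. exists (primitive k alpha b - primitive k alpha a)%C.
  split; [now apply integrand_is_RInt|]. apply HP.
  pose proof (Rmax_Cmod (primitive k alpha b - l)%C) as M.
  assert (M1 := Rle_trans _ _ _ (Rmax_l _ _) M).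
  assert (M2 := Rle_trans _ _ _ (Rmax_r _ _) M). clear M.
  set (u := primitive k alpha b) in *. set (v := primitive k alpha a) in *.
  change (Rabs (fst u + - fst l) <= Cmod (u - l)) in M1.
  change (Rabs (snd u + - snd l) <= Cmod (u - l)) in M2. split.
  + change (Rabs (fst u + - fst v - fst l) < e).
    replace (fst u + - fst v - fst l) with ((fst u + - fst l) + - fst v) by ring.
    eapply Rle_lt_trans; [apply Rabs_triang|]. rewrite Rabs_Ropp. lra.
  + change (Rabs (snd u + - snd v - snd l) < e).
    replace (snd u + - snd v - snd l) with ((snd u + - snd l) + - snd v) by ring.
    eapply Rle_lt_trans; [apply Rabs_triang|]. rewrite Rabs_Ropp. lra.
Qed.

End Primitive.

Lemma not_pos_int_Re_lt_1 alpha : Re alpha < 1 -> not_pos_int alpha.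
Proof. intros H n Hn ->. pose proof (INR_ge_1 n Hn). simpl in H. lra. Qed.

(** * Passage to the limit in [b] and [N] *)

Lemma ypow_lim_0 tau e : 0 < tau -> 0 < e ->
  exists delta, 0 < delta /\ forall b, b < 1 -> 1 - b < delta -> ypow tau b < e.
Proof.
intros Ht He. exists (exp (ln e / tau)). split; [apply exp_pos|].
intros b Hb Hd. apply ln_increasing in Hd; [|lra]. rewrite ln_exp in Hd.
rewrite <- (exp_ln e He). unfold ypow. apply exp_increasing.
apply (Rlt_div_r (ln (1 - b))) in Hd; [|lra]. lra.
Qed.

Lemma inv_sqrt_lim_0 D e : 0 < e ->
  exists N0, (1 <= N0)%nat /\ forall N, (N0 <= N)%nat -> D / sqrt (INR N) < e.
Proof.
intros He. pose proof (Rabs_pos D) as PD.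
assert (P : 0 <= (Rabs D / e + 1) ^ 2) by apply pow2_ge_0.
destruct (nfloor_ex _ P) as [n [_ Hn]]. exists (S n). split; [lia|].
intros N HN.
assert (Q : Rabs D / e + 1 < sqrt (INR N)).
{ assert (0 <= Rabs D / e) by (apply Rdiv_le_0_compat; lra).
  rewrite <- (sqrt_pow2 (Rabs D / e + 1)) by lra.
  apply sqrt_lt_1_alt. split; [exact P|].
  apply le_INR in HN. rewrite S_INR in HN. lra. }
assert (0 <= Rabs D / e) by (apply Rdiv_le_0_compat; lra).
apply Rlt_div_l; [lra|].
apply Rle_lt_trans with (Rabs D); [apply Rle_abs|].
replace (Rabs D) with (e * (Rabs D / e)) by (field; lra).
apply Rmult_lt_compat_l; lra.
Qed.

(** The order of choices is essential. [D] is independent of [N], so [N] is fixed first, making both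
    D/sqrt(N) and the truncation error of the star sum small; only then is [M] known, and [delta] is
    taken to suit it. *)
Lemma primitive_limit k alpha (l : C) : Forall (fun x => (1 <= x)%nat) k -> k <> [] ->
  Re alpha < 1 ->
  filterlim (star_sum (fun n => RtoC (INR n) - alpha)%C (fun _ => RtoC 1) (rev_dual_plus k))
    eventually (locally (T := C_UniformSpace) l) ->
  forall e, 0 < e -> exists delta, 0 < delta /\
     forall b, 0 < b < 1 -> 1 - b < delta ->
       Cmod (primitive k alpha b - (- RtoC 1) ^ length k * l) < e.
Proof.
intros Hk Nk Ha Hl.
destruct (dist_pos_ints alpha (not_pos_int_Re_lt_1 alpha Ha)) as [delta0 [c0 [Hd0 [Hc0 Hdist]]]].
assert (Hd : forall n, (1 <= n)%nat -> c0 * INR n <= Cmod (RtoC (INR n) - alpha)).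
{ intros n Hn. apply Hdist; [exact Hn|].
  replace (alpha - alpha)%C with (RtoC 0) by ring. rewrite Cmod_0. lra. }
(* At most half of the gap goes to [eps], so that [tau] stays positive; the cap [1] is required by
   [LiM_bound]. *)
set (eps := Rmin 1 ((1 - Re alpha) / 2)). set (tau := 1 - Re alpha - eps).
assert (Heps : 0 < eps <= 1) by (split; [apply Rmin_pos; lra|apply Rmin_l]).
assert (Heps2 : eps <= (1 - Re alpha) / 2) by apply Rmin_r.
assert (Htau : 0 < tau) by (unfold tau; lra).
assert (Hsum : Re alpha + eps + tau = 1) by (unfold tau; ring).
destruct (LiM_mono_bound alpha eps tau Heps Htau Hsum k Hk Nk) as [G [HG BG]].
destruct (LiM_kern_integral_estimate alpha eps tau c0 Heps Htau Hsum Hc0 Hd k Hk (fun _ => RtoC 1) G 1 HG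
  ltac:(lra)) as [D HD].
{ intros n Hn. rewrite Cmod_1. pose proof (sqrt_INR_ge_1 n Hn). lra. }
intros e He. assert (He3 : 0 < e / 3) by lra.
destruct (inv_sqrt_lim_0 D (e / 3) He3) as [N1 [HN1 H1]].
destruct (proj1 (filterlim_eventually_C _ _) Hl _ He3) as [N2 H2].
set (N := (N1 + N2)%nat).
assert (HN : (1 <= N)%nat) by (unfold N; lia).
specialize (H1 N ltac:(unfold N; lia)). specialize (H2 N ltac:(unfold N; lia)).
destruct (HD N HN (primitive k alpha)
  (fun x => RtoC (LiM k x / x) * mono alpha N x)%C) as [M HM].
- intros x Hx.
  assert (E : (RtoC (LiM k x) * kern alpha (fun _ => RtoC 1) N x
      + RtoC (LiM k x / x) * mono alpha N x)%C
    = (RtoC (slope0 (LiM k) x) * Rcpow (1 - x) (- alpha))%C).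
  (* Finite geometric sum: 1/x is the sum of (1-x)^(n-1) for n <= N, plus (1-x)^N / x. Hence the
     initial weight [1], and an initial error that [LiM_mono_bound] controls. *)
  { assert (K : Rcpow (1 - x) (- alpha) =
      (RtoC x * kern alpha (fun _ => RtoC 1) N x + mono alpha N x)%C).
    { clear. induction N as [|n IH]; unfold kern.
      - rewrite csum_0. unfold mono. simpl. ring.
      - rewrite csum_S. replace (S n - 1)%nat with n by lia.
        rewrite IH, mono_S. unfold kern. rewrite RtoC_minus. ring. }
    rewrite K, slope0_neq_0, RtoC_div by lra. field.
    intros Z. apply RtoC_inj in Z. lra. }
  rewrite E. apply primitive_is_cderive; [exact Hk|exact Nk|lra].
- eapply is_cderive_ccontinuous, primitive_is_cderive; [exact Hk|exact Nk|lra].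
- apply primitive_0.
- intros x Hx. eapply Rle_trans; [now apply BG|].
  apply Rmult_le_compat_r; [apply pow_le; lra|].
  pose proof (sqrt_INR_ge_1 N HN). nra.
- pose proof (Rabs_pos M) as PM.
  destruct (ypow_lim_0 tau (e / 3 / (Rabs M + 1)) Htau) as [delta [Hdelta Hy]];
    [apply Rdiv_lt_0_compat; lra|].
  exists delta. split; [exact Hdelta|]. intros b Hb Hbd.
  specialize (HM b Hb). specialize (Hy b ltac:(lra) Hbd).
  apply Rlt_div_r in Hy; [|lra].
  assert (Y : M * ypow tau b < e / 3).
  { pose proof (ypow_pos tau b). pose proof (Rle_abs M). nra. }
  set (Z := star_sum (fun n => RtoC (INR n) - alpha)%C (fun _ => RtoC 1) (rev_dual_plus k) N) in *.
  replace (primitive k alpha b - (- RtoC 1) ^ length k * l)%C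
    with ((primitive k alpha b - (- RtoC 1) ^ length k * Z) + (- RtoC 1) ^ length k * (Z - l))%C
    by ring.
  eapply Rle_lt_trans; [apply Cmod_triangle|].
  rewrite Cmod_mult, Cmod_pow, Cmod_opp, Cmod_1, pow1, Rmult_1_l. lra.
Qed.

Lemma zeta_star_trunc_shift k alpha N :
  zeta_star_trunc k (RtoC 1 - alpha) N =
  star_sum (fun n => RtoC (INR n) - alpha)%C (fun _ => RtoC 1) k N.
Proof.
revert N. induction k as [|x k IH]; intros N; [reflexivity|].
simpl. apply csum_ext. intros n _. rewrite IH.
now replace (RtoC (INR n) + (RtoC 1 - alpha) - RtoC 1)%C with (RtoC (INR n) - alpha)%C by ring.
Qed.

Lemma ex_derive_Cmult_l (c : C) (f : C -> C) a :
  ex_derive (K := C_AbsRing) (V := C_NormedModule) f a ->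
  ex_derive (K := C_AbsRing) (V := C_NormedModule) (fun a => c * f a)%C a.
Proof.
intros [l H]. exists (c * l)%C.
apply (filterdiff_ext_lin (K := C_AbsRing) (U := AbsRing_NormedModule C_AbsRing)
  (V := C_NormedModule) _ (fun y : C => (c * (y * l))%C)).
- apply (filterdiff_scal_r_fct (K := C_AbsRing) (U := AbsRing_NormedModule C_AbsRing)
    (V := C_NormedModule) c f (fun y : C => (y * l)%C)); [exact Cmult_comm|exact H].
- intros y. change (c * (y * l) = y * (c * l))%C. ring.
Qed.

Theorem theorem2p3 :
  forall (k : list nat) (alpha : C),
    is_composition k -> not_pos_int alpha ->
    exists zs : C,
      is_zeta_star (comp_plus (hoffman_dual (rev k))) (RtoC 1 - alpha)%C zs /\
      is_integral (integrand k) alpha ((- RtoC 1) ^ length k * zs)%C.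
Proof.
intros k alpha Hk Ha. rewrite comp_plus_hoffman_dual_rev by exact Hk.
destruct Hk as [Nk Hk].
(* The extra unit in the first entry makes it at least 2, which is what the convergence of the
   series rests on. *)
assert (Htl : Forall (fun x => (1 <= x)%nat) (tl (rev_dual_plus k))
   /\ (2 <= hd 0 (rev_dual_plus k))%nat).
{ rewrite rev_dual_plus_comp_plus by exact Nk.
  pose proof (rev_dual_pos k) as P. pose proof (rev_dual_neq_nil k Nk) as Q.
  destruct (rev_dual k) as [|x l]; [easy|]. inversion P; subst. simpl. split; [assumption|lia]. }
destruct Htl as [Htl Hhd].
set (z := fun a => star_sum (fun n => RtoC (INR n) - a)%C (fun _ => RtoC 1) (rev_dual_plus k)).
assert (L : forall a, not_pos_int a ->
  filterlim (z a) eventually (locally (T := C_UniformSpace) (climit (z a)))).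
{ intros a H. destruct (star_sum_lim_exists _ a H Htl Hhd) as [l Hl].
  fold (z a) in Hl. now rewrite (climit_correct _ _ Hl). }
exists (climit (z alpha)). split.
- unfold is_zeta_star. apply filterlim_ext with (z alpha); [|now apply L].
  intros N. symmetry. apply zeta_star_trunc_shift.
(* One function serves all [a]; the integral is evaluated only for [Re a < 1], and the value at
   [alpha] then holds by definition. *)
- exists (fun a => (- RtoC 1) ^ length k * climit (z a))%C. split; [|split; [|reflexivity]].
  + intros a H. apply ex_derive_Cmult_l.
    now apply (star_sum_lim_ex_derive (rev_dual_plus k) a (fun a => climit (z a))).
  + intros a H. apply integrand_is_int01; [exact Hk|exact Nk|].
    apply primitive_limit; [exact Hk|exact Nk|exact H|].
    apply L. now apply not_pos_int_Re_lt_1.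
Qed.
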